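(* Let $\mathbb{F}$ be any field, and let $\tilde n = n^5$. Any homogeneous $\Sigma\Pi\Sigma\Pi$ circuit over $\mathbb{F}$ computing the polynomial $IMM_{\tilde n, n}$ has size at least $2^{\Omega(\sqrt{n}\log n)}$.
   Context: For positive integers $a,b$, $IMM_{a,b}$ is the $(1,1)$ entry of the product $M_1M_2\cdots M_b$ of $b$ generic $a\times a$ matrices, i.e. matrices whose $a^2 b$ entries are distinct variables. A $\Sigma\Pi\Sigma\Pi$ circuit computes $\sum_{i=1}^T\prod_{j=1}^{d_i} Q_{i,j}$ with each $Q_{i,j}$ a sum of monomials (layers sum, product, sum, product from top to bottom); it is homogeneous if every node computes a homogeneous polynomial; its size is the number of nodes. *)

(* Defs.v *)
From mathcomp Require Import all_boot all_algebra.
From mathcomp Require Import mpoly.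

Set Implicit Arguments.
Unset Strict Implicit.
Unset Printing Implicit Defensive.

Import GRing.Theory.
Local Open Scope ring_scope.

(* Entry (i, j) of the k-th generic matrix is the variable (k, i, j).         *)
Definition imm_var (a b : nat) : finType := ('I_b * 'I_a * 'I_a)%type.

Definition generic_mx (F : fieldType) (a b : nat) (k : 'I_b) :
    'M[{mpoly F[#|imm_var a b|]}]_a :=
  \matrix_(i, j) 'X_(enum_rank ((k, i, j) : imm_var a b)).

(* Rows and columns are numbered from 0, so the (1,1) entry has index (0,0).  *)
Definition IMM (F : fieldType) (a b : nat) (a_gt0 : (0 < a)%N) :
    {mpoly F[#|imm_var a b|]} :=
  (\prod_(k < b) generic_mx F a k) (Ordinal a_gt0) (Ordinal a_gt0).

(* A circuit is a layered directed acyclic graph.  Each gate carries the list *)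
(* of its children in the layer below: sharing of nodes is allowed, and so    *)
(* are parallel wires (the monomial x^2 is a product gate with two wires from *)
(* the leaf x).  Coefficients enter through leaves labelled by constants.     *)
Record SPSP (F : fieldType) (N : nat) := MkSPSP {
  n_leaf : nat;
  n_mono : nat;
  n_sum : nat;
  n_prod : nat;
  leaf_label : 'I_n_leaf -> 'I_N + F;
  mono_children : 'I_n_mono -> seq 'I_n_leaf;
  sum_children : 'I_n_sum -> seq 'I_n_mono;
  prod_children : 'I_n_prod -> seq 'I_n_sum;
  top_children : seq 'I_n_prod
}.

Section Semantics.

Variables (F : fieldType) (N : nat) (C : SPSP F N).

Definition leaf_poly (i : 'I_(n_leaf C)) : {mpoly F[N]} :=
  match leaf_label i with
  | inl v => 'X_v
  | inr c => c%:MP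
  end.

Definition mono_poly (i : 'I_(n_mono C)) : {mpoly F[N]} :=
  \prod_(j <- mono_children i) leaf_poly j.

Definition sum_poly (i : 'I_(n_sum C)) : {mpoly F[N]} :=
  \sum_(j <- sum_children i) mono_poly j.

Definition prod_poly (i : 'I_(n_prod C)) : {mpoly F[N]} :=
  \prod_(j <- prod_children i) sum_poly j.

Definition output : {mpoly F[N]} := \sum_(j <- top_children C) prod_poly j.

(* The final 1 is the output gate.                                            *)
Definition circuit_size : nat :=
  (n_leaf C + n_mono C + n_sum C + n_prod C + 1)%N.

(* The zero polynomial is homogeneous of every degree.                        *)
Definition is_homogeneous (p : {mpoly F[N]}) : Prop :=
  exists d : nat, p \is d.-homog.

Definition homogeneous_circuit : Prop :=
  [/\ forall i, is_homogeneous (leaf_poly i),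
      forall i, is_homogeneous (mono_poly i),
      forall i, is_homogeneous (sum_poly i),
      forall i, is_homogeneous (prod_poly i)
    & is_homogeneous output].

End Semantics.

(* Main.v *)
(* Proof idea (projected shifted partial derivatives, over an arbitrary field).

   Restrict IMM to the generating polynomial of the walks in a layered graph made of k ~ sqrt n blocks of
   length r ~ sqrt n.  The first variable y_{j,b} of block j chooses one of q disjoint copies of the same
   graph, in which the walk then visits vertices 0 = v_0, v_1, ..., v_R = 0 of [P], the segment from v_i to
   v_{i+1} consisting of m variables that occur in no other segment.  Every variable has nu ~ sqrt n parallel
   copies and a labelling keeps one of them; a random labelling kills a monomial with more than nu distinct
   variables with probability at least 1 - nu^-(nu+1), so if there are few monomial gates then some labelling
   kills them all.

   We work modulo the squares of the variables.  If a product of n factors of degree at most s is shifted by a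
   square-free monomial of degree l and one extracts the coefficient of a monomial in k variables y, the result
   lies in the span of the products of all but at most k of the (y-free parts of the) factors with monomials of
   degree between l and l + ks.  For the walk polynomial the same coefficients are the sums of z^(S + walk) over the
   walks that avoid S.  Call (walk, S) isolated if no other walk from the same sources avoids S and no
   other walk is contained in S + walk: the corresponding rows and columns form an identity matrix, so the number of
   isolated pairs bounds the rank from below.  Giving S the weight x^|S| turns the counts into products over
   the blocks; here w = 1/x is just above 1, so that w^nu = sqrt nu while w^r > nu^3.  Two walks that
   diverge differ in at least one segment more than the number of vertices in which they differ, which
   makes the expected number of competitors of a walk small, and a first-moment bound suffices. *)

From HB Require Import structures.
Require Import Defs.
From mathcomp Require Import all_boot all_order all_algebra.
From mathcomp Require Import ring lra zify.
From mathcomp Require Import reals sequences exp.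
From mathcomp Require Import mpoly.

Set Implicit Arguments.
Unset Strict Implicit.
Unset Printing Implicit Defensive.

Import Order.TTheory GRing.Theory Num.Theory.
Local Open Scope ring_scope.

(** * Square-free polynomials *)

(** Models the polynomial ring modulo the squares of the variables: the value at a set is the
    coefficient of the square-free monomial supported there. Products therefore sum over splittings
    into disjoint sets. *)
Definition sqf (F : fieldType) (V : finType) := {ffun {set V} -> F}.

Section Squarefree.

Variables (F : fieldType) (V : finType).
Implicit Types (f g : sqf F V) (A B : {set V}).

HB.instance Definition _ := GRing.Zmodule.on (sqf F V).

Definition sqf_const (c : F) : sqf F V := [ffun A => if A == set0 then c else 0].

Definition sqf_var (v : V) : sqf F V := [ffun A => (A == [set v])%:R].

Definition sqf_mul f g : sqf F V :=
  [ffun A : {set V} => \sum_(B : {set V} | B \subset A) f B * g (A :\: B)].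

Fact sqf_mulC : commutative sqf_mul.
Proof.
move=> f g; apply/ffunP => A; rewrite !ffunE.
rewrite (reindex_onto (fun B => A :\: B) (fun B => A :\: B)) /=; last first.
  by move=> B BA; rewrite setDDr setDv set0U; apply/setIidPr.
apply: eq_big => [B|B]; last first.
  by case/andP=> _ /eqP eB; rewrite mulrC eB.
rewrite subsetDl /= setDDr setDv set0U.
by apply/eqP/setIidPr.
Qed.

Fact sqf_mulA : associative sqf_mul.
Proof.
move=> f g h; apply/ffunP => A; rewrite !ffunE.
under eq_bigr => B BA do rewrite ffunE mulr_sumr.
under [RHS]eq_bigr => B BA do rewrite ffunE mulr_suml.
rewrite [RHS](exchange_big_dep (fun B => B \subset A)) /=; last first.
  by move=> B C BA CB; apply: subset_trans BA.
apply: eq_bigr => C CA.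
rewrite [RHS](reindex_onto (fun D => C :|: D) (fun B => B :\: C)) /=; last first.
  move=> B /andP[_ CB]; apply/setP => v; rewrite !inE.
  by case: (boolP (v \in C)) => //= /(subsetP CB) ->.
have condE D : ((C :|: D \subset A) && (C \subset C :|: D)
    && ((C :|: D) :\: C == D)) = (D \subset A :\: C).
  rewrite subUset CA subsetUl /= andbT setDUl setDv set0U subsetD.
  by congr (_ && _); apply/eqP/idP => [/setDidPl|/setDidPl].
apply: eq_big => [D|D DA]; first by rewrite condE.
rewrite mulrA setDDl; congr (_ * g _ * _).
move: DA; rewrite subsetD => /andP[_ DC].
by rewrite setDUl setDv set0U; apply/esym/setDidPl.
Qed.

Fact sqf_mul1 : left_id (sqf_const 1) sqf_mul.
Proof.
move=> f; apply/ffunP => A; rewrite !ffunE (bigD1 set0) ?sub0set //=.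
rewrite ffunE eqxx mul1r setD0 big1 ?addr0 // => B /andP[_ /negPf B0].
by rewrite ffunE B0 mul0r.
Qed.

Fact sqf_mulDl : left_distributive sqf_mul +%R.
Proof.
move=> f g h; apply/ffunP => A; rewrite !ffunE -big_split /=.
by apply: eq_bigr => B _; rewrite ffunE mulrDl.
Qed.

Fact sqf_1_neq0 : sqf_const 1 != 0.
Proof.
apply/eqP => /ffunP /(_ set0); rewrite !ffunE eqxx => /eqP.
by rewrite oner_eq0.
Qed.

HB.instance Definition _ := GRing.Zmodule_isComNzRing.Build (sqf F V)
  sqf_mulA sqf_mulC sqf_mul1 sqf_mulDl sqf_1_neq0.

Lemma sqfM f g A :
  (f * g) A = \sum_(B : {set V} | B \subset A) f B * g (A :\: B).
Proof. by rewrite ffunE. Qed.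

Lemma sqf1 A : (1 : sqf F V) A = (A == set0)%:R.
Proof. by rewrite ffunE; case: eqP. Qed.

Lemma sqf_sum (I : Type) (r : seq I) (P : pred I) (G : I -> sqf F V) A :
  (\sum_(i <- r | P i) G i) A = \sum_(i <- r | P i) G i A.
Proof. by elim/big_rec2: _ => [|i a b _ <-]; rewrite ffunE. Qed.

Fact sqf_const_zmod_morphism : zmod_morphism sqf_const.
Proof.
by move=> a b; apply/ffunP => A; rewrite !ffunE; case: eqP; rewrite ?subr0.
Qed.

Fact sqf_const_monoid_morphism : monoid_morphism sqf_const.
Proof.
split=> // a b; apply/ffunP => A; rewrite sqfM (bigD1 set0) ?sub0set //=.
rewrite setD0 big1 => [|B /andP[_ /negPf B0]]; last by rewrite ffunE B0 mul0r.
by rewrite !ffunE eqxx addr0; case: eqP; rewrite ?mulr0.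
Qed.

HB.instance Definition _ :=
  GRing.isZmodMorphism.Build F (sqf F V) sqf_const sqf_const_zmod_morphism.
HB.instance Definition _ :=
  GRing.isMonoidMorphism.Build F (sqf F V) sqf_const sqf_const_monoid_morphism.

Lemma sqf_mul_const c f A : (sqf_const c * f) A = c * f A.
Proof.
rewrite sqfM (bigD1 set0) ?sub0set //= setD0 ffunE eqxx big1 ?addr0 //.
by move=> B /andP[_ /negPf B0]; rewrite ffunE B0 mul0r.
Qed.

Lemma sqf_mul_var f v A :
  (f * sqf_var v) A = if v \in A then f (A :\ v) else 0.
Proof.
rewrite mulrC sqfM; case: ifP => vA.
  rewrite (bigD1 [set v]) ?sub1set //= ffunE eqxx mul1r big1 ?addr0 //.
  by move=> B /andP[_ /negPf B1]; rewrite ffunE B1 mul0r.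
apply: big1 => B BA; rewrite ffunE; case: eqP => [eB|]; last by rewrite mul0r.
by move: BA; rewrite eB sub1set vA.
Qed.

Lemma sqf_neq0P f : reflect (exists A, f A != 0) (f != 0).
Proof.
apply: (iffP idP) => [f0|[A]]; last by apply: contra_neq => ->; rewrite ffunE.
apply/existsP; apply: contraNT f0 => /existsPn f0.
by apply/eqP/ffunP => A; rewrite ffunE; apply/eqP; move: (f0 A); rewrite negbK.
Qed.

Lemma sqfM_neq0 f g A : (f * g) A != 0 ->
  exists B, [/\ B \subset A, f B != 0 & g (A :\: B) != 0].
Proof.
rewrite sqfM => nz.
suff /existsP[B /and3P[? ? ?]] : [exists B : {set V},
  [&& B \subset A, f B != 0 & g (A :\: B) != 0]] by exists B.
apply: contraNT nz => /existsPn nz; rewrite big1 // => B BA.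
apply/eqP; rewrite mulf_eq0; move: (nz B); rewrite BA /=.
by rewrite negb_and !negbK.
Qed.

Lemma sqf_prod_neq0 (I : eqType) (r : seq I) (G : I -> sqf F V) A :
    (\prod_(i <- r) G i) A != 0 ->
  (forall i, i \in r -> G i != 0) /\
  (forall v, v \in A -> exists i B, [/\ i \in r, v \in B & G i B != 0]).
Proof.
elim: r A => [|i r IH] A.
  rewrite big_nil sqf1; case: (A =P set0) => [->|_]; last by rewrite eqxx.
  by split => // v; rewrite inE.
rewrite big_cons => /sqfM_neq0[B [BA GB /IH[r0 rA]]]; split.
  move=> j; rewrite inE => /orP[/eqP->|]; last exact: r0.
  by apply/sqf_neq0P; exists B.
move=> v vA; case vB: (v \in B).
  by exists i, B; rewrite inE eqxx.
have [|j [C [jr vC GC]]] := rA v; first by rewrite inE vB.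
by exists j, C; rewrite inE jr orbT.
Qed.

Lemma sqf_prod_deg (I : finType) (J : {set I}) (G : I -> sqf F V) s A :
    (forall i B, G i B != 0 -> (#|B| <= s)%N) ->
  (\prod_(i in J) G i) A != 0 -> (#|A| <= #|J| * s)%N.
Proof.
move=> Gs; rewrite -sum_nat_const -!big_enum /=.
elim: (enum _) A => [|i r IH] A.
  by rewrite !big_nil sqf1; case: (A =P set0) => [->|_]; rewrite ?cards0 ?eqxx.
rewrite !big_cons => /sqfM_neq0[B [BA /Gs Bs /IH rB]].
by rewrite -(setID A B) (setIidPr BA) (leq_trans (leq_card_setU _ _)) ?leq_add.
Qed.

End Squarefree.

(** * Shifted partial derivatives of a product *)

(** An identity matrix of size [#|D|] that factors through dimension [#|E|] forces the inequality;
    this is the form in which rank enters the argument. *)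
Lemma card_le_of_factorization (F : fieldType) (I K : finType)
    (D : {pred I}) (E : {pred K}) (L : I -> K -> F) (M : K -> I -> F) :
    {in D &, forall i j, \sum_(c in E) L i c * M c j = (i == j)%:R} ->
  (#|D| <= #|E|)%N.
Proof.
move=> LM.
pose A : 'M[F]_(#|D|, #|E|) := \matrix_(a, b) L (enum_val a) (enum_val b).
pose B : 'M[F]_(#|E|, #|D|) := \matrix_(b, a) M (enum_val b) (enum_val a).
apply: (@mulmx1_min _ _ _ A B); apply/matrixP => a a'; rewrite !mxE.
under eq_bigr => b _ do rewrite !mxE.
rewrite -(big_enum_val (fun c => L (enum_val a) c * M c (enum_val a'))).
by rewrite LM ?enum_valP // (inj_eq enum_val_inj).
Qed.

Section UpperBound.

Variables (F : fieldType) (V : finType) (Ys : {set V}).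

Definition sqf_low (f : sqf F V) : sqf F V :=
  [ffun A : {set V} => if [disjoint A & Ys] then f A else 0].

Definition sqf_high (f : sqf F V) : sqf F V :=
  [ffun A : {set V} => if [disjoint A & Ys] then 0 else f A].

Lemma sqf_high_low f : f = sqf_high f + sqf_low f.
Proof. by apply/ffunP => A; rewrite !ffunE; case: ifP; rewrite ?add0r ?addr0. Qed.

(** Each high factor contributes a variable of [Ys], and the contributions to a square-free monomial
    are disjoint. *)
Lemma sqf_prod_high_neq0 (I : finType) (J : {set I}) (f : I -> sqf F V) A :
  (\prod_(i in J) sqf_high (f i)) A != 0 -> (#|J| <= #|A :&: Ys|)%N.
Proof.
rewrite -[#|J|]sum1_card -!big_enum /=.
elim: (enum _) A => [|i r IH] A; first by rewrite !big_nil.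
rewrite !big_cons => /sqfM_neq0[B [BA hB /IH rB]].
have B_gt0 : (0 < #|B :&: Ys|)%N.
  rewrite card_gt0 setI_eq0; apply: contraNN hB => dB.
  by rewrite ffunE dB.
have -> : A :&: Ys = (B :&: Ys) :|: ((A :\: B) :&: Ys).
  apply/setP => v; rewrite !inE.
  by case: (boolP (v \in B)) => //= /(subsetP BA) ->; rewrite orbF.
rewrite cardsU (_ : (B :&: Ys) :&: _ = set0) ?cards0 ?subn0 ?leq_add //.
by apply/setP => v; rewrite !inE; case: (v \in B); rewrite ?andbF ?andFb.
Qed.

Lemma sqf_prod_low_neq0 (I : finType) (J : {set I}) (f : I -> sqf F V) A :
  (\prod_(i in J) sqf_low (f i)) A != 0 -> [disjoint A & Ys].
Proof.
rewrite -big_enum => /sqf_prod_neq0[_ fA]; apply/pred0P => v; apply/negP.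
rewrite inE /= => /andP[/fA[i [B [_ vB hB]]] vY]; move: hB.
rewrite ffunE; case: ifP => [dB _|]; last by rewrite eqxx.
by move/pred0P/(_ v): dB; rewrite /= vB vY.
Qed.

Variables (n k s : nat) (q : 'I_n -> sqf F V).
Hypothesis q_deg : forall i A, q i A != 0 -> (#|A| <= s)%N.

(** Expand every factor into its high and low part and let [J] be the set of factors taken high.
    Only few factors can be high, and the rest of the product no longer depends on [B]. *)
Lemma sqf_prod_split (B W : {set V}) :
    B \subset Ys -> (#|B| <= k)%N -> W \subset ~: Ys ->
  (\prod_i q i) (B :|: W) =
  \sum_(J : {set 'I_n} | (#|J| <= k)%N)
    \sum_(W1 : {set V} | (W1 \subset W) && (#|W1| <= k * s)%N)
      (\prod_(i in J) sqf_high (q i)) (B :|: W1) *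
      (\prod_(i in ~: J) sqf_low (q i)) (W :\: W1).
Proof.
move=> BY Bk WY.
have WYd : [disjoint W & Ys] by rewrite disjoints_subset.
have BWd : [disjoint B & W].
  by rewrite disjoint_sym; apply: disjointWr WYd.
have BWY : (B :|: W) :&: Ys = B.
  rewrite setIUl (setIidPl BY) (_ : W :&: Ys = set0) ?setU0 //.
  by apply/eqP; rewrite setI_eq0.
under eq_bigr => i _ do rewrite (sqf_high_low (q i)).
rewrite bigA_distr sqf_sum [RHS]big_mkcond /=; apply: eq_bigr => J _.
have -> : \prod_i (if i \in J then sqf_high (q i) else sqf_low (q i)) =
   (\prod_(i in J) sqf_high (q i)) * (\prod_(i in ~: J) sqf_low (q i)).
  rewrite (bigID (mem J)) /=; congr (_ * _).
    by apply: eq_bigr => i ->.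
  apply: eq_big => [i|i /negPf-> //]; by rewrite !inE.
set P1 := \prod_(i in J) _; set P2 := \prod_(i in ~: J) _.
have P1_high A : P1 A != 0 -> (#|J| <= #|A :&: Ys|)%N by apply: sqf_prod_high_neq0.
have P1_deg A : P1 A != 0 -> (#|A| <= #|J| * s)%N.
  apply: sqf_prod_deg => i C; rewrite ffunE; case: ifP; rewrite ?eqxx // => _.
  exact: q_deg.
have P2_low A : P2 A != 0 -> [disjoint A & Ys] by apply: sqf_prod_low_neq0.
(* More than [k] high factors would use more than [k] variables of [Ys], but [B :|: W] contains only
   those of [B]. *)
rewrite sqfM; case: ifPn => [Jk|]; last first.
  rewrite -ltnNge => Jk; apply: big1 => C CBW; apply/eqP; rewrite mulf_eq0.
  apply/orP; left; apply: contraTT Jk => /P1_high Jle.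
  rewrite -leqNgt (leq_trans Jle) // (leq_trans _ Bk) // subset_leq_card //.
  by rewrite -BWY setSI.
(* Low factors are free of [Ys], so all of [B] has to come from the high ones. *)
rewrite (bigID (fun C : {set V} => B \subset C)) /= addrC big1 ?add0r; last first.
  move=> C /andP[_ BC]; apply/eqP; rewrite mulf_eq0; apply/orP; right.
  apply: contraNT BC => /P2_low /pred0P CY; apply/subsetP => v vB.
  move: (CY v); rewrite !inE vB (subsetP BY _ vB) /= !andbT.
  by case: (v \in C).
rewrite (reindex_onto (fun W1 => B :|: W1) (fun C => C :\: B)) /=; last first.
  move=> C /andP[_ BC]; apply/setP => v; rewrite !inE.
  by case: (boolP (v \in B)) => //= /(subsetP BC) ->.
rewrite (eq_bigl (fun W1 : {set V} => W1 \subset W)) /=; last first.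
  move=> W1; rewrite subsetUl andbT; apply/andP/idP => [[sub /eqP eW1]|sub].
    apply/subsetP => v; rewrite -eW1 !inE => /andP[vB].
    rewrite (negPf vB) /= => vW1.
    by have := subsetP sub v; rewrite !inE vW1 orbT (negPf vB) => /(_ isT).
  split; first by rewrite setUS.
  apply/eqP/setP => v; rewrite !inE; case: (boolP (v \in B)) => //= vB.
  apply/esym/negP => /(subsetP sub) vW.
  by move/pred0P/(_ v): BWd; rewrite /= vB vW.
(* At most [k] high factors of degree at most [s] can take at most [k * s] variables of [W]. *)
rewrite (bigID (fun W1 : {set V} => (#|W1| <= k * s)%N)) /= [X in _ + X]big1 ?addr0.
  apply: eq_bigr => W1 _; congr (_ * P2 _).
  apply/setP => v; rewrite !inE; case: (boolP (v \in B)) => //= vB.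
  apply/esym/negP => /andP[_ vW].
  by move/pred0P/(_ v): BWd; rewrite /= vB vW.
move=> W1 /andP[_]; rewrite -ltnNge => W1k; apply/eqP; rewrite mulf_eq0.
apply/orP; left; apply: contraTT W1k => /P1_deg W1s; rewrite -leqNgt.
rewrite (leq_trans (subset_leq_card (subsetUr B W1))) // (leq_trans W1s) //.
by rewrite leq_mul2r Jk orbT.
Qed.

End UpperBound.

(** Row [i] is the coefficient of the monomial [B i], shifted by the monomial [S i]; column [j]
    reads off the monomial [U j]. This matrix factors through triples of a gate, a set of at most
    [k] high factors and a monomial of bounded degree. *)
Theorem card_shifted_partials (F : fieldType) (V I : finType) (Ys : {set V})
    (T n k s l : nat) (c : 'I_T -> F) (q : 'I_T -> 'I_n -> sqf F V)
    (D : {pred I}) (B S U : I -> {set V}) :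
    (forall g i A, q g i A != 0 -> (#|A| <= s)%N) ->
    (forall i, B i \subset Ys /\ (#|B i| <= k)%N) ->
    (forall i, U i \subset ~: Ys) -> (forall i, i \in D -> #|S i| = l) ->
    {in D &, forall i j, (if S i \subset U j then
        \sum_g c g * (\prod_a q g a) (B i :|: (U j :\: S i)) else 0) = (i == j)%:R} ->
  (#|D| <= T * #|[set J : {set 'I_n} | (#|J| <= k)%N]|
       * #|[set A : {set V} | [&& A \subset ~: Ys, l <= #|A| & #|A| <= l + k * s]]|)%N.
Proof.
move=> q_deg BY UY Sl delta.
pose E := [pred x : 'I_T * {set 'I_n} * {set V} | (#|x.1.2| <= k)%N &
  [&& x.2 \subset ~: Ys, l <= #|x.2| & #|x.2| <= l + k * s]%N].
(* The high factors supply [B i] and extend the shift [S i] to the monomial [x.2]; in [M] the low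
   factors complete [x.2] to [U j], independently of [i]. *)
pose L i (x : 'I_T * {set 'I_n} * {set V}) := if S i \subset x.2 then
  c x.1.1 * (\prod_(a in x.1.2) sqf_high Ys (q x.1.1 a)) (B i :|: (x.2 :\: S i)) else 0.
pose M (x : 'I_T * {set 'I_n} * {set V}) j := if x.2 \subset U j then
  (\prod_(a in ~: x.1.2) sqf_low Ys (q x.1.1 a)) (U j :\: x.2) else 0.
have -> : (T * #|[set J : {set 'I_n} | (#|J| <= k)%N]|
       * #|[set A : {set V} | [&& A \subset ~: Ys, l <= #|A| & #|A| <= l + k * s]]| = #|E|)%N.
  rewrite -[T in LHS]card_ord -cardsT -!cardsX; apply: eq_card => -[[g J] A].
  by rewrite !inE.
apply: (card_le_of_factorization (L := L) (M := M)) => i j Di Dj.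
rewrite -delta //; case: ifP => SU; last first.
  apply: big1 => x _; rewrite /L /M; case: ifP => Sx; last by rewrite mul0r.
  case: ifP => xU; last by rewrite mulr0.
  by rewrite (subset_trans Sx xU) in SU.
transitivity (\sum_g \sum_(J : {set 'I_n} | (#|J| <= k)%N)
  \sum_(A : {set V} | [&& A \subset ~: Ys, l <= #|A| & #|A| <= l + k * s]%N)
   L i (g, J, A) * M (g, J, A) j).
  rewrite pair_big_dep /= pair_big_dep /=.
  by apply: eq_big => [[[g J] A]|[[g J] A] _] //=; rewrite !inE.
apply: eq_bigr => g _; have [BYi Bk] := BY i.
rewrite (sqf_prod_split (q_deg g) BYi Bk) ?mulr_sumr; last first.
  by apply: subset_trans (UY j); apply: subsetDl.
apply: eq_bigr => J Jk; rewrite mulr_sumr.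
rewrite (bigID (fun A : {set V} => (S i \subset A) && (A \subset U j))) /=.
rewrite [X in _ + X]big1 ?addr0; last first.
  move=> A /andP[_]; rewrite negb_and /L /M /= => /orP[/negPf->|/negPf->].
    by rewrite mul0r.
  by rewrite mulr0.
rewrite (reindex_onto (fun W => S i :|: W) (fun A => A :\: S i)) /=; last first.
  move=> A /andP[_ /andP[SA _]]; apply/setP => v; rewrite !inE.
  by case: (boolP (v \in S i)) => //= /(subsetP SA) ->.
have SW (W : {set V}) : W \subset U j :\: S i -> (S i :|: W) :\: S i = W.
  rewrite subsetD => /andP[_ WS].
  by rewrite setDUl setDv set0U; apply/setDidPl.
apply: eq_big => [W|W].
  rewrite subsetUl /=; apply/idP/idP.
    case/andP=> /andP[/and3P[_ _ Wk] WU] /eqP eW.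
    have WUS : W \subset U j :\: S i.
      rewrite -eW; apply/subsetP => v; rewrite !inE => /andP[-> /=].
      by move=> vW; apply: (subsetP WU); rewrite inE.
    rewrite WUS /=; move: Wk; rewrite cardsU -(Sl i Di) (_ : _ :&: _ = set0).
      by rewrite cards0 subn0 leq_add2l.
    apply/eqP; rewrite setI_eq0 disjoint_sym.
    by move: WUS; rewrite subsetD => /andP[].
  case/andP=> WUS Wk; rewrite SW // eqxx andbT.
  have [WU WS] := andP (etrans (esym (subsetD _ _ _)) WUS).
  have SWU : S i :|: W \subset U j by rewrite subUset SU.
  rewrite (subset_trans SWU (UY j)) SWU andbT /= cardsU (Sl i Di).
  rewrite (_ : _ :&: _ = set0); last by apply/eqP; rewrite setI_eq0 disjoint_sym.
  by rewrite cards0 subn0 leq_addr leq_add2l.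
case/andP=> /andP[_ /andP[_ SWU]] /eqP eW; rewrite /L /M /= subsetUl SWU eW.
by rewrite mulrA setDDl.
Qed.

(** * Random labellings *)

Section RandomLabels.

Variables (V : finType) (p : nat).
Implicit Types (Lab : {set V * 'I_p}) (rho : {ffun V -> 'I_p}).

Definition agrees Lab rho := [forall x in Lab, rho x.1 == x.2].

(** Agreement leaves at most one label for each variable occurring in [Lab]; conflicting demands
    only lower the count. *)
Lemma card_agrees Lab :
  (#|[set rho | agrees Lab rho]| * p ^ #|[set x.1 | x in Lab]| <= p ^ #|V|)%N.
Proof.
set Dm := [set x.1 | x in Lab].
pose Fa (v : V) := [pred l : 'I_p | [forall x in Lab, (x.1 == v) ==> (x.2 == l)]].
have sub : (#|[set rho | agrees Lab rho]| <= \prod_v #|Fa v|)%N.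
  rewrite -[X in (_ <= X)%N](_ : #|family Fa| = _); last first.
    by rewrite card_family /image_mem foldrE big_map big_enum.
  apply/subset_leq_card/subsetP => rho; rewrite inE => /forall_inP ag.
  apply/familyP => v; rewrite inE; apply/forall_inP => x xL.
  by apply/implyP => /eqP <-; rewrite eq_sym ag.
apply: leq_trans (leq_mul sub (leqnn _)) _.
have -> : (p ^ #|Dm| = \prod_v (if v \in Dm then p else 1))%N.
  by rewrite -big_mkcond prod_nat_const.
have -> : (p ^ #|V| = \prod_(v : V) p)%N by rewrite prod_nat_const.
rewrite -big_split /=; apply: leq_prod => v _; case: ifP => vD; last first.
  by rewrite muln1 -[X in (_ <= X)%N]card_ord; apply: max_card.
rewrite -[X in (_ <= X)%N]mul1n leq_mul2r; apply/orP; right.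
have /imsetP[[v' l] xL /= ev] := vD; subst v'.
rewrite -(card1 l); apply/subset_leq_card/subsetP => l'; rewrite !inE => /forall_inP.
by move=> /(_ _ xL) /implyP /(_ (eqxx _)) /eqP /= ->.
Qed.

(** Union bound: a set with more than [s] variables agrees with at most one labelling in
    [p ^ s.+1]. *)
Lemma exists_good_labelling (M s : nat) (Lab : 'I_M -> {set V * 'I_p}) :
    (M < p ^ s.+1)%N ->
  exists rho, forall g, agrees (Lab g) rho -> (#|[set x.1 | x in Lab g]| <= s)%N.
Proof.
move=> M_lt.
have p_gt0 : (0 < p)%N.
  by move: M_lt; rewrite lt0n; apply: contraTneq => ->; rewrite exp0n // ltn0.
pose bad g := [set rho | agrees (Lab g) rho & (s < #|[set x.1 | x in Lab g]|)%N].
have bad_le g : (#|bad g| * p ^ s.+1 <= p ^ #|V|)%N.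
  have [big|small] := ltnP s #|[set x.1 | x in Lab g]|.
    apply: leq_trans (card_agrees (Lab g)); apply: leq_mul.
      by apply/subset_leq_card/subsetP => rho; rewrite !inE => /andP[].
    by rewrite leq_pexp2l.
  rewrite (_ : bad g = set0) ?cards0 ?mul0n //.
  by apply/setP => rho; rewrite !inE ltnNge small andbF.
have : (#|\bigcup_g bad g| < #|{ffun V -> 'I_p}|)%N.
  rewrite card_ffun card_ord -(ltn_pmul2r (_ : 0 < p ^ s.+1)%N) ?expn_gt0 ?p_gt0 //.
  apply: leq_ltn_trans (_ : M * p ^ #|V| < _)%N; last first.
    by rewrite mulnC ltn_pmul2l // expn_gt0 p_gt0.
  apply: leq_trans (_ : (\sum_g #|bad g|) * p ^ s.+1 <= _)%N.
    rewrite leq_mul2r; apply/orP; right.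
    elim/big_rec2: _ => [|g a B _ IH]; first by rewrite cards0.
    by rewrite (leq_trans (leq_card_setU _ _)) // leq_add2l.
  rewrite big_distrl /= -[M in leqRHS]card_ord -sum_nat_const.
  by apply: leq_sum => g _; apply: bad_le.
rewrite -[X in (_ < X)%N]cardsT => lt.
have /subsetPn[rho _ nb] : ~~ ([set: {ffun V -> 'I_p}] \subset \bigcup_g bad g).
  by apply: contraL lt => /subset_leq_card; rewrite leqNgt.
exists rho => g ag; rewrite leqNgt; apply: contra nb => big.
by apply/bigcupP; exists g; rewrite // inE ag.
Qed.

End RandomLabels.

(** * Walks *)

Section Walks.

Variables (R : comNzRingType) (St : finType).

Fixpoint walk_sum (g : St -> R) (K : nat -> St -> St -> R) (h : nat) (a : St) : R :=
  if h is h'.+1 then \sum_a' walk_sum g K h' a' * K h' a' a else g a.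

Definition ffun_rcons h (c : {ffun 'I_h.+1 -> St}) (a : St) : {ffun 'I_h.+2 -> St} :=
  [ffun i : 'I_h.+2 => if (i < h.+1)%N then c (inord i) else a].

Lemma sum_ffun_rcons h (G : {ffun 'I_h.+2 -> St} -> R) :
  \sum_c G c = \sum_(c : {ffun 'I_h.+1 -> St}) \sum_a G (ffun_rcons c a).
Proof.
rewrite pair_big /=.
pose back (d : {ffun 'I_h.+2 -> St}) :=
  ([ffun i : 'I_h.+1 => d (inord i)], d ord_max) : {ffun 'I_h.+1 -> St} * St.
rewrite (reindex (fun x => ffun_rcons x.1 x.2)) //=.
exists back => [[c a] _|d _]; rewrite /back /=.
  congr pair; last by rewrite ffunE /= ltnn.
  apply/ffunP => i; have ih := ltn_ord i.
  by rewrite !ffunE inordK; [rewrite ifT ?inord_val|apply: ltnW].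
apply/ffunP => i; rewrite !ffunE; case: ltnP => hi.
  by rewrite inordK // inord_val.
by congr (d _); apply/val_inj => /=; apply/eqP; rewrite eqn_leq hi -ltnS ltn_ord.
Qed.

(** Transfer-matrix expansion. The final weight [e] is arbitrary so that the induction can absorb
    the last step into it. *)
Lemma walk_sumE g K h (e : St -> R) :
  \sum_a walk_sum g K h a * e a =
  \sum_(c : {ffun 'I_h.+1 -> St})
    g (c ord0) * (\prod_(i < h) K i (c (inord i)) (c (inord i.+1))) * e (c ord_max).
Proof.
elim: h e => [|h IH] e /=.
  rewrite (reindex (fun c : {ffun 'I_1 -> St} => c ord0)) /=.
    apply: eq_bigr => c _; rewrite big_ord0 mulr1; congr (_ * e (c _)).
    exact: val_inj.
  exists (fun a => [ffun=> a]) => [c _|a _]; last by rewrite ffunE.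
  by apply/ffunP => i; rewrite ffunE; congr (c _); rewrite [i]ord1.
under eq_bigr => a _ do rewrite mulr_suml.
rewrite exchange_big /=.
under eq_bigr => a' _.
  under eq_bigr => a _ do rewrite -mulrA.
  rewrite -mulr_sumr; over.
rewrite IH sum_ffun_rcons; apply: eq_bigr => c _; rewrite mulr_sumr.
apply: eq_bigr => a _; rewrite big_ord_recr /= mulrA.
congr (_ * _); last by rewrite ffunE ltnn.
rewrite -mulrA; congr (_ * _).
  by rewrite ffunE /=; congr (g (c _)); apply/val_inj; rewrite /= inordK.
congr (_ * _).
  apply: eq_bigr => i _; have ih := ltn_ord i.
  have ih1 : (i <= h)%N by apply: ltnW.
  have ih2 : (i <= h.+1)%N by apply: leqW.
  by rewrite !ffunE !inordK ?ltnS ?ih ?ih1 ?ih2.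
rewrite !ffunE !inordK ?ltnS ?leqnn // ltnn; congr (K _ (c _) _).
by apply/val_inj; rewrite /= inordK.
Qed.

End Walks.

Lemma sqf_prod_var (F : fieldType) (V : finType) (I : finType) (v : I -> V) (A : {set V}) :
    injective v ->
  (\prod_i sqf_var F (v i)) A = (A == [set v i | i : I])%:R.
Proof.
move=> v_inj; have -> : [set v i | i : I] = [set w | w \in [seq v i | i <- enum I]].
  by apply/setP => w; rewrite inE; apply/imsetP/mapP => -[i _ ->]; exists i;
    rewrite ?mem_enum.
rewrite -big_enum /=; elim: (enum I) (enum_uniq I) A => [|i r IH] /= ur A.
  by rewrite big_nil sqf1 (_ : [set w | w \in [::]] = set0).
have /andP[ir {}ur] := ur.
rewrite big_cons mulrC sqf_mul_var IH //; case: ifP => vA.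
  congr (nat_of_bool _)%:R; apply/eqP/eqP => [eA|->].
    rewrite -(setD1K vA) eA; apply/setP => w; by rewrite !inE.
  apply/setP => w; rewrite !inE; case: eqP => //= ->.
  by rewrite (mem_map v_inj) (negPf ir).
case: eqP => // eA; move: vA; rewrite eA inE /= in_cons eqxx //.
Qed.

(** * Restricting iterated matrix multiplication *)

Section Restriction.

Variables (F : fieldType) (St : finType) (p H a n : nat).
Variables (start fin : pred St) (rel : nat -> St -> St -> bool).
Variable rho : {ffun 'I_H.+1 * St -> 'I_p.+1}.
Hypothesis size_le : (#|{: St * 'I_p.+1}| <= a)%N.
Hypothesis a_gt0 : (0 < a)%N.
Hypothesis len_le : (H.+1.*2.+1 <= n)%N.

Let V : finType := ('I_H.+1 * St)%type.
Let Node : finType := (St * 'I_p.+1)%type.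
Let i0 : 'I_a := Ordinal a_gt0.

(** Indices in the image of [enc] are nodes of the layered graph; the others carry no weight in the
    inner layers. Index [i0], where the product begins and ends, may or may not be a node, which
    explains the case distinctions on [dec i0]. *)
Definition enc (x : Node) : 'I_a := widen_ord size_le (enum_rank x).

Definition dec (i : 'I_a) : option Node := [pick x | enc x == i].

Lemma enc_inj : injective enc.
Proof. by move=> x y [/val_inj/enum_rank_inj]. Qed.

Lemma decP i x : dec i = Some x -> i = enc x.
Proof. by rewrite /dec; case: pickP => // y /eqP <- [->]. Qed.

Lemma encK x : dec (enc x) = Some x.
Proof.
rewrite /dec; case: pickP => [y /eqP/enc_inj -> //|/(_ x)].
by rewrite eqxx.
Qed.

Lemma sum_dec (R : nmodType) (G : 'I_a -> R) :
  (forall i, dec i = None -> G i = 0) -> \sum_i G i = \sum_x G (enc x).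
Proof.
move=> G0; rewrite (bigID (fun i => dec i)) /= [X in _ + X]big1 ?addr0; last first.
  by move=> i; case e: (dec i) => // _; apply: G0.
rewrite (reindex_omap (enc) (dec)) /=; last first.
  by move=> i; case e: (dec i) => [x|] //= _; rewrite (decP e).
by apply: eq_bigl => x; rewrite encK /= eqxx.
Qed.

Lemma sum_dec2 (R : nmodType) (G : 'I_a -> R) :
    (forall i, dec i = None -> G i = 0) ->
  \sum_i G i = \sum_s \sum_lb G (enc (s, lb)).
Proof.
by move=> /sum_dec->; rewrite pair_big; apply: eq_bigr => -[].
Qed.

(* Layer [2h+1] reads the [h]-th state of a walk and carries the only surviving variables; layer [2h] encodes
   the transition to that state and consists of constants.  The random label [rho (h, s)] decides which of
   the [p.+1] parallel copies of the variable attached to [(h, s)] survives. *)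
Definition entry (l : nat) (i j : 'I_a) : sqf F V :=
  if (H.+1.*2 < l)%N then ((i == i0) && (j == i0))%:R
  else if odd l then
    match dec i, dec j with
    | Some (s, lb), Some (s', lb') =>
        if [&& lb == ord0, s == s' & lb' == rho (inord l./2, s')]
        then sqf_var F (inord l./2, s') else 0
    | _, _ => 0
    end
  else match dec i, dec j with
    | Some (s, _), Some (s', lb') =>
        if l == 0%N then ((i == i0) && (lb' == ord0) && start s')%:R
        else if l == H.+1.*2 then (fin s && (j == i0))%:R
        else ((lb' == ord0) && rel l./2.-1 s s')%:R
    | Some (s, _), None => ((l == H.+1.*2) && fin s && (j == i0))%:R
    | None, Some (s', lb') => [&& l == 0%N, i == i0, lb' == ord0 & start s']%:R
    | None, None => 0
    end.

Fixpoint row_vec (l : nat) (j : 'I_a) : sqf F V :=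
  if l is l'.+1 then \sum_i row_vec l' i * entry l' i j else (j == i0)%:R.

Lemma row_vec0 j : row_vec 0 j = (j == i0)%:R.
Proof. by []. Qed.

Lemma row_vecS l j : row_vec l.+1 j = \sum_i row_vec l i * entry l i j.
Proof. by []. Qed.

#[local] Arguments row_vec : simpl never.

Definition restriction (v : 'I_#|imm_var a n|) : sqf F V :=
  let: (l, i, j) := enum_val v in entry l i j.

Definition restrict (P : {mpoly F[#|imm_var a n|]}) : sqf F V :=
  mmap (@sqf_const F V) restriction P.

Lemma restrict_IMM_row_vec : restrict (IMM F n a_gt0) = row_vec n i0.
Proof.
rewrite /restrict /IMM.
have -> (M : 'M[{mpoly F[#|imm_var a n|]}]_a) i j :
    mmap (@sqf_const F V) restriction (M i j) =
    map_mx (mmap (@sqf_const F V) restriction) M i j by rewrite mxE.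
rewrite rmorph_prod /=.
have step l : (l <= n)%N -> forall (E : nat -> 'M[sqf F V]_a),
  (forall l i j, E l i j = entry l i j) -> forall j,
  (\prod_(k < l) E k) i0 j = row_vec l j.
  move=> _ E eE; elim: l => [|l IH] j; first by rewrite big_ord0 mxE eq_sym.
  rewrite big_ord_recr /= mxE; apply: eq_bigr => i _; by rewrite IH eE.
rewrite -(step n _ (fun l => \matrix_(i, j) entry l i j)) //; last first.
  by move=> l i j; rewrite mxE.
congr (fun_of_matrix _ _ _); apply: eq_bigr => k _.
apply/matrixP => i j; rewrite !mxE mmapX mmap1U /restriction enum_rankK.
by [].
Qed.

Let K (h : nat) (s s' : St) : sqf F V := sqf_var F (inord h, s) * (rel h s s')%:R.
Let ws := walk_sum (fun s => (start s)%:R) K.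

(** The only edge out of [(s, ord0)] in this layer leads to the label selected by [rho] and carries
    the variable of [(h, s)]. *)
Lemma row_vec_even h : (h < H.+1)%N ->
  (forall s, row_vec h.*2.+1 (enc (s, ord0)) = ws h s) ->
  forall s lb, row_vec h.*2.+2 (enc (s, lb)) =
   if lb == rho (inord h, s) then ws h s * sqf_var F (inord h, s) else 0.
Proof.
move=> hH odd_eq s lb; rewrite row_vecS.
have lt : (H.+1.*2 < h.*2.+1)%N = false by rewrite ltnS leq_double leqNgt hH.
rewrite sum_dec; last first.
  by move=> i di; rewrite /entry lt /= odd_double /= di mulr0.
rewrite (bigD1 (s, ord0)) //=; rewrite odd_eq.
rewrite big1 ?addr0 => [|[s' l'] ne]; rewrite /entry lt /= odd_double /= !encK.
  rewrite !eqxx /= uphalf_double; case: ifP; rewrite ?mulr0 //.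
case: ifP => [/and3P[/eqP e1 /eqP e2 _]|]; last by rewrite mulr0.
by rewrite e1 e2 eqxx in ne.
Qed.

(** The constant layers lead from every label back to [ord0]. The variable of the current state is
    read by the next layer only, hence is absent from [ws h s]. *)
Lemma row_vec_odd h : (h <= H)%N ->
  forall s, row_vec h.*2.+1 (enc (s, ord0)) = ws h s.
Proof.
elim: h => [|h IH] hH s.
  rewrite row_vecS (bigD1 i0) //= big1 ?addr0 => [|i /negPf ne]; last first.
    by rewrite row_vec0 ne mul0r.
  rewrite row_vec0 eqxx mul1r /entry /= encK eqxx; by case: (dec i0) => [[]|].
rewrite doubleS.
rewrite row_vecS.
have lt : (H.+1.*2 < h.*2.+2)%N = false.
  by rewrite -doubleS ltn_double ltnNge (leqW hH).
have ne : (h.*2.+2 == H.+1.*2)%N = false.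
  by rewrite -doubleS -!muln2 eqn_pmul2r //; apply/negbTE; rewrite neq_ltn ltnS hH.
rewrite sum_dec2; last first.
  by move=> i di; rewrite /entry lt /= odd_double /= di encK mulr0.
apply: eq_bigr => s' _.
rewrite (bigD1 (rho (inord h, s'))) //= big1 ?addr0 => [|lb nlb]; last first.
  rewrite row_vec_even ?(negPf nlb) ?mul0r //.
    exact: leqW.
  by apply: IH; apply: ltnW.
rewrite row_vec_even ?eqxx; last first.
- by apply: IH; apply: ltnW.
- exact: leqW.
by rewrite /entry lt /= odd_double /= !encK ne /= doubleK /K mulrA.
Qed.

Definition valid_walk (c : {ffun 'I_H.+1 -> St}) :=
  [&& start (c ord0), fin (c ord_max) &
    [forall i : 'I_H, rel i (c (inord i)) (c (inord i.+1))]].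

Definition graph (c : {ffun 'I_H.+1 -> St}) : {set V} := [set (i, c i) | i : 'I_H.+1].

Lemma graph_inj : injective graph.
Proof.
move=> c c' e; apply/ffunP => i.
have : (i, c i) \in graph c' by rewrite -e; apply/imsetP; exists i.
by case/imsetP => i' _ [-> ->].
Qed.

Lemma row_vec_end : row_vec H.+1.*2.+1 i0 = \sum_s ws H s * (sqf_var F (inord H, s) * (fin s)%:R).
Proof.
rewrite row_vecS sum_dec2; last first.
  by move=> i di; rewrite /entry ltnn odd_double di /=; case: (dec _) => [[]|] *;
    rewrite mulr0.
have ev := row_vec_even (ltnSn H) (row_vec_odd (leqnn H)).
apply: eq_bigr => s _.
rewrite (bigD1 (rho (inord H, s))) //= big1 ?addr0 => [|lb nlb]; last first.
  by rewrite ev ?(negPf nlb) ?mul0r.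
rewrite ev eqxx mulrA; congr (_ * _).
rewrite /entry ltnn odd_double encK !eqxx andbT /=; by case: (dec i0) => [[]|].
Qed.

(** The layers after the last transition only carry [i0] along, so a product of [n] matrices can
    host a shorter walk. *)
Lemma row_vec_tail l j : (H.+1.*2 < l)%N ->
  row_vec l j = (j == i0)%:R * row_vec H.+1.*2.+1 i0.
Proof.
elim: l j => // l IH j; rewrite ltnS leq_eqVlt => /orP[/eqP<-|lt].
  have [->|ne] := eqVneq j i0; first by rewrite mul1r.
  rewrite mul0r row_vecS; apply: big1 => i _.
  by rewrite /entry ltnn odd_double (negPf ne) /=;
    case: (dec i) => [[]|]; case: (dec j) => [[]|] *; rewrite ?eqxx ?andbF mulr0.
rewrite row_vecS (bigD1 i0) //= big1 ?addr0 => [|i ne].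
  by rewrite IH // /entry lt eqxx /= mul1r mulrC.
by rewrite /entry lt (negPf ne) mulr0.
Qed.

(** Distinct walks have distinct graphs, so no coefficients add up and the result is the same in
    every characteristic. *)
Lemma restrict_IMM A :
  restrict (IMM F n a_gt0) A = [exists c, valid_walk c && (A == graph c)]%:R.
Proof.
rewrite restrict_IMM_row_vec row_vec_tail // eqxx mul1r row_vec_end walk_sumE sqf_sum.
transitivity (\sum_(c : {ffun 'I_H.+1 -> St}) (valid_walk c && (A == graph c))%:R : F).
  apply: eq_bigr => c _; rewrite /K big_split /=.
  have -> : \prod_(i < H) (rel i (c (inord i)) (c (inord i.+1)))%:R =
     [forall i : 'I_H, rel i (c (inord i)) (c (inord i.+1))]%:R :> sqf F V.
    case: forallP => [all_rel|/forallP/forallPn[i /negPf ri]].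
      by rewrite big1 // => i _; rewrite all_rel.
    by rewrite (bigD1 i) //= ri mul0r.
  set b1 := start _; set b2 := fin _; set b3 := [forall i, _].
  set X := \prod_(i < H) _.
  have -> : b1%:R * (X * b3%:R) * (sqf_var F (inord H, c ord_max) * b2%:R) =
     (b1 && (b2 && b3))%:R * (X * sqf_var F (inord H, c ord_max)) :> sqf F V.
    by case: b1 b2 b3 => [] [] []; rewrite ?(mul0r, mulr0, mul1r, mulr1).
  have -> : X * sqf_var F (inord H, c ord_max) = \prod_i sqf_var F (i, c i).
    rewrite big_ord_recr /=; congr (_ * sqf_var _ (_, _)); last first.
      by apply/val_inj; rewrite /= inordK.
    apply: eq_bigr => i _; have -> : inord i = widen_ord (leqnSn H) i :> 'I_H.+1.
      by apply/val_inj; rewrite /= inordK // leqW.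
    by [].
  rewrite -/(valid_walk c); case: (valid_walk c); last by rewrite mul0r ffunE.
  by rewrite mul1r sqf_prod_var // => i j [].
case: existsP => [[c /andP[vc /eqP eA]]|nex].
  rewrite (bigD1 c) //= vc eA eqxx big1 ?addr0 // => c' ne.
  by rewrite (inj_eq graph_inj) eq_sym (negPf ne) andbF.
apply: big1 => c _; case e: (_ && _) => //; by case: nex; exists c.
Qed.

End Restriction.

(** * Restricting homogeneous circuits *)

Section Homogeneous.

Variables (F : fieldType) (N : nat).
Implicit Types (P : {mpoly F[N]}) (l : seq {mpoly F[N]}).

Lemma dhomog0_const P : P \is 0.-homog -> P = (P@_0%MM)%:MP.
Proof.
move=> P0; apply/mpolyP => m; rewrite mcoeffC.
have [->|ne] := eqVneq m 0%MM; first by rewrite mulr1.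
rewrite mulr0; apply: (dhomog_nemf_coeff P0).
by rewrite mdeg_eq0.
Qed.

Lemma dhomog_prod_seq l : (forall P, P \in l -> is_homogeneous P) ->
  is_homogeneous (\prod_(P <- l) P).
Proof.
by move=> hl; apply/homogP/homog_prod/allP => P /hl/homogP.
Qed.

(** Factors of degree 0 are constants and are collected in [c]; each remaining factor uses up at
    least one unit of the degree [d]. *)
Lemma dhomog_prod_factors d l :
    (forall P, P \in l -> is_homogeneous P) ->
    \prod_(P <- l) P != 0 -> \prod_(P <- l) P \is d.-homog ->
  exists c l', [/\ (size l' <= d)%N, {subset l' <= l} &
    \prod_(P <- l) P = c%:MP * \prod_(P <- l') P].
Proof.
elim: l d => [|P l IH] d hl.
  by exists 1, [::]; rewrite big_nil mul1r.
rewrite big_cons mulf_eq0 negb_or => /andP[P0 l0] Pld.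
have [|a Pa] := hl P; first by rewrite inE eqxx.
have hl' Q : Q \in l -> is_homogeneous Q by move=> Ql; apply: hl; rewrite inE Ql orbT.
have [b lb] := dhomog_prod_seq hl'.
have eab : (a + b)%N = d.
  by apply: dhomog_uniq (dhomogM Pa lb) Pld; rewrite mulf_neq0.
have [c [l' [sl' sub e]]] := IH _ hl' l0 lb.
case: a Pa eab => [|a] Pa eab.
  exists (P@_0%MM * c), l'; split.
  - by rewrite -eab.
  - by move=> Q /sub; rewrite inE orbC => ->.
  - by rewrite {1}(dhomog0_const Pa) e mpolyCM mulrA.
exists c, (P :: l'); split.
- by rewrite /= -eab addSn ltnS (leq_trans sl') ?leq_addl.
- by move=> Q; rewrite !inE => /orP[->//|/sub ->]; rewrite orbT.
- by rewrite big_cons e mulrCA.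
Qed.

End Homogeneous.

Lemma prod_nth1 (R : comNzRingType) (n : nat) (l : seq R) :
  (size l <= n)%N -> \prod_(i < n) nth 1 l i = \prod_(x <- l) x.
Proof.
move=> sl; rewrite (big_nth 1) big_mkord (big_ord_widen n (fun i => nth 1 l i) sl).
rewrite [RHS]big_mkcond; apply: eq_bigr => i _.
by case: ltnP => // si; rewrite nth_default.
Qed.

Lemma IMM_homog (F : fieldType) (a b : nat) (a_gt0 : (0 < a)%N) :
  IMM F b a_gt0 \is b.-homog.
Proof.
rewrite /IMM; move: (Ordinal a_gt0) => i; move: (Ordinal a_gt0) => j.
pose E (k : nat) : 'M[{mpoly F[#|imm_var a b|]}]_a :=
  if insub k is Some k' then generic_mx F a k' else 0.
have -> : \prod_(k < b) generic_mx F a k = \prod_(k < b) E k.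
  by apply: eq_bigr => k _; rewrite /E valK.
have E_homog k i' j' : E k i' j' \is 1.-homog.
  rewrite /E; case: insubP => [k' _ _|_]; rewrite !mxE ?dhomog0 //.
  by rewrite dhomogX; apply/eqP/mdeg1.
suff prod_homog m j' : (\prod_(k < m) E k) i j' \is m.-homog by [].
elim: m j' => [|m IH] j'; last first.
  rewrite big_ord_recr mxE; apply: rpred_sum => k _.
  by have := dhomogM (IH k) (E_homog m k j'); rewrite addn1.
by rewrite big_ord0 mxE; case: eqP => _; rewrite ?dhomog0 //; apply: dhomog1.
Qed.

Section Circuit.

Variables (F : fieldType) (N n : nat) (C : SPSP F N).
Hypothesis C_homog : homogeneous_circuit C.

(** The degree [n] part of a homogeneous gate is either 0 or the whole gate. In the second case at
    most [n] factors are non-constant, and the list is padded with 1 to length exactly [n]. *)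
Lemma prod_poly_factors (g : 'I_(n_prod C)) :
  exists c (q : 'I_n -> {mpoly F[N]}),
    (forall i, q i = 1 \/ exists j : 'I_(n_sum C), q i = sum_poly j) /\
    pihomog mdeg n (prod_poly g) = c%:MP * \prod_i q i.
Proof.
have [_ _ hsum hprod _] := C_homog.
have zero_case : pihomog mdeg n (prod_poly g) = 0 -> exists c (q : 'I_n -> {mpoly F[N]}),
    (forall i, q i = 1 \/ exists j : 'I_(n_sum C), q i = sum_poly j) /\
    pihomog mdeg n (prod_poly g) = c%:MP * \prod_i q i.
  by move=> ->; exists 0, (fun=> 1); split; [left|rewrite mul0r].
have [d gd] := hprod g.
have [edn|nd] := eqVneq d n; last by apply: zero_case; apply: pihomog_ne0 nd gd.
rewrite edn in gd; have [g0|g0] := eqVneq (prod_poly g) 0.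
  by apply: zero_case; rewrite g0 raddf0.
rewrite (pihomog_dE gd).
pose l := [seq sum_poly j | j <- prod_children g].
have el : prod_poly g = \prod_(P <- l) P by rewrite big_map.
rewrite el in gd g0 *.
have hl P : P \in l -> is_homogeneous P by case/mapP => j _ ->.
have [c [l' [sl' sub ->]]] := dhomog_prod_factors hl g0 gd.
exists c, (fun i => nth 1 l' i); split; last by rewrite prod_nth1.
move=> i; have [il|il] := ltnP i (size l'); last by left; rewrite nth_default.
right; have /sub/mapP[j _ ->] : nth 1 l' i \in l' by apply: mem_nth.
by exists j.
Qed.

(** Taking degree [n] parts leaves the output unchanged. Parallel wires into one product gate become
    a multiplicity, which leaves one term per gate. *)
Lemma output_decomposition : output C \is n.-homog ->
  exists (c : 'I_(n_prod C) -> F) (q : 'I_(n_prod C) -> 'I_n -> {mpoly F[N]}),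
    (forall g i, q g i = 1 \/ exists j : 'I_(n_sum C), q g i = sum_poly j) /\
    output C = \sum_g (c g)%:MP * \prod_i q g i.
Proof.
move=> oh.
have [c cP] := fin_all_exists prod_poly_factors.
have [q qP] := fin_all_exists cP.
exists (fun g => (count_mem g (top_children C))%:R * c g), q; split.
  by move=> g; have [] := qP g.
rewrite -[LHS](pihomog_dE oh) /output raddf_sum /=.
rewrite (partition_big id xpredT) //=; apply: eq_bigr => g _.
rewrite mpolyCM -mulrA; have [_ <-] := qP g; rewrite mpolyC_nat mulr_natl.
rewrite (eq_bigr (fun=> pihomog mdeg n (prod_poly g))) => [|j /eqP-> //].
by rewrite big_const_seq iter_addr_0.
Qed.

End Circuit.

Section RestrictedCircuit.

Variables (F : fieldType) (St : finType) (p H a n : nat).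
Variables (start fin : pred St) (rel : nat -> St -> St -> bool).
Hypothesis size_le : (#|{: St * 'I_p.+1}| <= a)%N.
Hypothesis a_gt0 : (0 < a)%N.
Hypothesis len_le : (H.+1.*2.+1 <= n)%N.

(** Does not depend on the labelling: it gives the position, state and copy for the variables that a
    labelling may keep as variables. All others are sent to constants. *)
Definition var_label (v : 'I_#|imm_var a n|) : option ('I_H.+1 * St * 'I_p.+1) :=
  let: (l, i, j) := enum_val v in
  if (l <= H.+1.*2)%N && odd l then
    match dec size_le i, dec size_le j with
    | Some (s, lb), Some (s', lb') =>
        if (lb == ord0) && (s == s') then Some (inord l./2, s', lb') else None
    | _, _ => None
    end
  else None.

Variable rho : {ffun 'I_H.+1 * St -> 'I_p.+1}.

Let res := @restriction F _ _ _ _ n start fin rel rho size_le a_gt0.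

Lemma restriction_var v x : var_label v = Some x ->
  res v = if rho x.1 == x.2 then sqf_var F x.1 else 0.
Proof.
rewrite /var_label /res /restriction; case: (enum_val v) => [[l i] j].
case: ifP => // /andP[le odd_l]; rewrite /entry ltnNge le /= odd_l.
case: (dec size_le i) => [[s lb]|] //; case: (dec size_le j) => [[s' lb']|] //.
by case: ifP => // /andP[-> ->] [<-] /=; rewrite eq_sym.
Qed.

Lemma restriction_const v A : var_label v = None -> res v A != 0 -> A = set0.
Proof.
have natA (b : bool) : (b%:R : sqf F ('I_H.+1 * St)%type) A != 0 -> A = set0.
  case: b; last by rewrite ffunE eqxx.
  by rewrite sqf1; case: (A =P set0) => // _; rewrite eqxx.
have zA : (0 : sqf F ('I_H.+1 * St)%type) A != 0 -> A = set0 by rewrite ffunE eqxx.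
rewrite /var_label /res /restriction; case: (enum_val v) => [[l i] j].
rewrite /entry leqNgt; case: (_ < l)%N => /=; first by move=> _; apply: natA.
case: (odd l) => /=.
  case: (dec size_le i) => [[s lb]|]; last by move=> _; apply: zA.
  case: (dec size_le j) => [[s' lb']|]; last by move=> _; apply: zA.
  by rewrite andbA; case: ((lb == ord0) && (s == s')) => //= _; apply: zA.
move=> _; case: (dec size_le i) => [[s lb]|]; case: (dec size_le j) => [[s' lb']|];
  do ?[case: ifP => _]; by [apply: natA | apply: zA].
Qed.

Definition mono_labels (C : SPSP F #|imm_var a n|) (g : 'I_(n_mono C)) :
    {set 'I_H.+1 * St * 'I_p.+1} :=
  [set x | has (fun j => if leaf_label j is inl v then var_label v == Some x else false)
    (mono_children g)].

Lemma restrict_mono (C : SPSP F #|imm_var a n|) (g : 'I_(n_mono C)) A :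
    restrict start fin rel rho size_le a_gt0 (mono_poly g) A != 0 ->
  agrees (mono_labels g) rho /\ A \subset [set x.1 | x in mono_labels g].
Proof.
rewrite /restrict /mono_poly rmorph_prod /= => /sqf_prod_neq0[nz cov].
split.
  apply/forall_inP => x; rewrite inE => /hasP[j jg].
  case e: (leaf_label j) => [v|//] /eqP lv.
  have := nz j jg; rewrite /leaf_poly e mmapX mmap1U -/(res v) (restriction_var lv).
  by case: ifP; rewrite ?eqxx.
apply/subsetP => v /cov[j [B [jg vB]]]; rewrite /leaf_poly.
case e: (leaf_label j) => [w|c]; last first.
  rewrite mmapC ffunE; case: (B =P set0) vB => [->|_ _]; first by rewrite inE.
  by rewrite eqxx.
rewrite mmapX mmap1U -/(res w); case lw: (var_label w) => [x|]; last first.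
  by move/(restriction_const lw) => B0; move: vB; rewrite B0 inE.
rewrite (restriction_var lw); case: ifP => _; last by rewrite ffunE eqxx.
rewrite ffunE; case: (B =P _) vB => [->|]; last by rewrite eqxx.
rewrite inE => /eqP -> _; apply/imsetP; exists x => //.
by rewrite inE; apply/hasP; exists j => //; rewrite e lw.
Qed.

(** A monomial gate survives only if all its labels agree with [rho]. Modulo squares its degree is
    the number of distinct variables, so high powers do no harm. *)
Lemma restrict_sum_deg (C : SPSP F #|imm_var a n|) s (j : 'I_(n_sum C)) A :
    (forall g : 'I_(n_mono C), agrees (mono_labels g) rho ->
       (#|[set x.1 | x in mono_labels g]| <= s)%N) ->
  restrict start fin rel rho size_le a_gt0 (sum_poly j) A != 0 -> (#|A| <= s)%N.
Proof.
move=> good; rewrite /restrict /sum_poly rmorph_sum sqf_sum.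
rewrite big_seq; elim/big_rec: _ => [|g x _ IH]; first by rewrite eqxx.
have [e|ne _] := eqVneq (restrict start fin rel rho size_le a_gt0 (mono_poly g) A) 0.
  by rewrite -/(restrict _ _ _ _ _ _ _) e add0r.
have [/good le sub] := restrict_mono ne.
exact: leq_trans (subset_leq_card sub) le.
Qed.

End RestrictedCircuit.

(** * Walks inside a block *)

Section Blocks.

Variables (q p m R k : nat).
Hypotheses (m_gt0 : (0 < m)%N) (R_gt0 : (0 < R)%N).

Definition state : finType := ('I_q * 'I_p.+1 * 'I_p.+1)%type.
Definition bpath : finType := ('I_q * {ffun 'I_R.+1 -> 'I_p.+1})%type.
Definition blen : nat := (R * m)%N.

Implicit Types (s : state) (x y : bpath).

Definition start s := (s.1.2 == ord0) && (s.2 == ord0).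
Definition fin s := s.2 == ord0.
(* A state (b, u, v) is a step of the segment from vertex u to vertex v in copy b; segments end at
   the multiples of m. *)
Definition brel (i : nat) s s' :=
  if (m %| i)%N then (s'.1.1 == s.1.1) && (s'.1.2 == s.2) else s' == s.
Definition closed x := (x.2 ord0 == ord0) && (x.2 ord_max == ord0).

Definition seg_state x (t : nat) : state :=
  (x.1, x.2 (inord (t %/ m)), x.2 (inord (t %/ m).+1)).
(** Position 0 is the source, whose variable chooses the copy [x.1]; position [t.+1] is step [t] of
    the path, which explains the shift by one. *)
Definition walk_state x (i : nat) : state :=
  if i is t.+1 then seg_state x t else (x.1, ord0, ord0).

Lemma blen_gt0 : (0 < blen)%N.
Proof. by rewrite muln_gt0 R_gt0. Qed.

Lemma walk_state_start x : start (walk_state x 0).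
Proof. by rewrite /start /= !eqxx. Qed.

Lemma walk_state_fin x : closed x -> fin (walk_state x blen).
Proof.
case/andP=> _ xR; rewrite /fin; case e: blen => [|t] //=; rewrite /seg_state /=.
have -> : (t %/ m).+1 = R.
  have := blen_gt0; rewrite e => _; have -> : t = (R.-1 * m + m.-1)%N.
    apply/succn_inj; rewrite -e /blen -addnS prednK // -mulSnr prednK //.
  rewrite divnMDl // divn_small ?addn0 ?prednK //.
by rewrite -(eqP xR); apply/eqP; congr (x.2 _); apply/val_inj; rewrite /= inordK.
Qed.

Lemma walk_state_rel x i : closed x -> (i < blen)%N ->
  brel i (walk_state x i) (walk_state x i.+1).
Proof.
case/andP=> x0 _ lt; rewrite /brel; case: ifPn => [dv|ndv]; rewrite /= ?eqxx /=.
  case: i lt dv => [|i] lt dv /=.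
    by rewrite /seg_state /= eqxx div0n -(eqP x0); apply/eqP; congr (x.2 _); apply/val_inj; rewrite /= inordK.
  by rewrite /seg_state /= eqxx divnS // dv add1n /=.
case: i lt ndv => [|i] lt ndv /=; first by rewrite dvdn0 in ndv.
by rewrite /seg_state divnS // (negPf ndv).
Qed.

(** The state is constant inside a segment, and a new segment starts at the vertex where the
    previous one ended, so the states at the multiples of [m] determine the walk. *)
Lemma walk_stateP (D : nat -> state) :
    start (D 0%N) -> (forall i, (i < blen)%N -> brel i (D i) (D i.+1)) -> fin (D blen) ->
  exists2 x, closed x & forall i, (i <= blen)%N -> D i = walk_state x i.
Proof.
move=> D0 Drel DR.
have const g l : (g < R)%N -> (0 < l <= m)%N -> D (g * m + l)%N = D (g * m + 1)%N.
  move=> sR; elim: l => // -[//|l] IH /andP[_ lm]; rewrite addnS.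
  rewrite -IH ?(ltnW lm) //; apply/eqP.
  have := Drel (g * m + l.+1)%N; rewrite /brel dvdn_addr ?dvdn_mull //.
  rewrite gtnNdvd // -addnS; apply.
  apply: (@leq_trans (g.+1 * m)); last by rewrite leq_mul2r sR orbT.
  by rewrite mulSnr leq_add2l.
have seg0 g : (g < R)%N ->
    ((D (g * m + 1)%N).1.1 = (D (g * m)%N).1.1) * ((D (g * m + 1)%N).1.2 = (D (g * m)%N).2).
  move=> sR; have := Drel (g * m)%N; rewrite /brel dvdn_mull // addn1.
  by rewrite ltn_mul2r m_gt0 sR => /(_ isT) /andP[/eqP-> /eqP->].
have base g : (g <= R)%N -> (D (g * m)%N).1.1 = (D 0%N).1.1.
  elim: g => [//|g IH] sR; rewrite mulSnr const ?m_gt0 ?leqnn //.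
  by rewrite seg0 // IH // ltnW.
(* Vertex [i] is the end of the segment that finishes at position [i * m]; for [i = 0] it is the
   vertex of the source. *)
pose x : bpath := ((D 0%N).1.1, [ffun i : 'I_R.+1 => (D (i * m)%N).2]).
exists x.
  rewrite /closed !ffunE /= mul0n -/blen; apply/andP; split=> //.
  by case/andP: D0.
case=> [|t] tR /=.
  move: D0; rewrite /start; case: (D 0%N) => [[b u] v] /= /andP[/eqP-> /eqP->].
  by [].
have sR : (t %/ m < R)%N by rewrite ltn_divLR.
have -> : D t.+1 = D (t %/ m * m + 1)%N.
  rewrite {1}(divn_eq t m) -addnS const // ltn_mod m_gt0 //.
rewrite /seg_state !ffunE !inordK ?ltnS ?(ltnW sR) //.
have e1 := seg0 _ sR; have e2 := const (t %/ m)%N m sR.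
rewrite -[D _]/(D (t %/ m * m + 1)%N) [D _]surjective_pairing [(D _).1]surjective_pairing.
by rewrite !e1 base ?(ltnW sR) // mulSnr e2 ?m_gt0 ?leqnn.
Qed.

End Blocks.

(** * Walks across all blocks *)

Section GlobalWalks.

Variables (q p m R k : nat).
Hypotheses (m_gt0 : (0 < m)%N) (R_gt0 : (0 < R)%N).

Local Notation r := (blen m R).
Local Notation state := (state q p).
Local Notation bpath := (bpath q p R).
Local Notation H := (k * r.+1 + r)%N.
Local Notation V := ('I_H.+1 * state)%type.

Implicit Types (y : {ffun 'I_k.+1 -> bpath}) (c : {ffun 'I_H.+1 -> state}).

Definition grel (h : nat) (s s' : state) :=
  if (h %% r.+1 == r)%N then fin s && start s' else brel m (h %% r.+1) s s'.

Definition walk y : {ffun 'I_H.+1 -> state} :=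
  [ffun h : 'I_H.+1 => walk_state m (y (inord (h %/ r.+1))) (h %% r.+1)].

Definition pos (j : 'I_k.+1) (i : 'I_r.+1) : 'I_H.+1 := inord (j * r.+1 + i).

Lemma val_pos j i : pos j i = (j * r.+1 + i)%N :> nat.
Proof.
rewrite /= inordK // -addnS; apply: leq_trans (_ : j.+1 * r.+1 <= _)%N.
  by rewrite mulSnr leq_add2l.
by rewrite -addnS -mulSnr leq_mul2r ltn_ord orbT.
Qed.

Lemma pos_div j i : (pos j i %/ r.+1)%N = j.
Proof. by rewrite val_pos divnMDl // divn_small // addn0. Qed.

Lemma pos_mod j i : (pos j i %% r.+1)%N = i.
Proof. by rewrite val_pos modnMDl modn_small. Qed.

Lemma posP (h : 'I_H.+1) : exists j i, h = pos j i.
Proof.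
have jk : (h %/ r.+1 < k.+1)%N.
  by rewrite ltn_divLR // (leq_trans (ltn_ord h)) // mulSnr addnS.
have ir : (h %% r.+1 < r.+1)%N by rewrite ltn_mod.
exists (Ordinal jk), (Ordinal ir); apply/val_inj.
by rewrite [RHS]val_pos -divn_eq.
Qed.

Lemma pos_inj j i j' i' : pos j i = pos j' i' -> j = j' /\ i = i'.
Proof.
move=> e; split; apply/val_inj.
  by rewrite /= -(pos_div j i) e pos_div.
by rewrite /= -(pos_mod j i) e pos_mod.
Qed.

Lemma walk_pos y j i : walk y (pos j i) = walk_state m (y j) i.
Proof. by rewrite ffunE pos_div pos_mod inord_val. Qed.

(** Between two blocks only [fin] and [start] are required, so the blocks can be chosen
    independently of each other. *)
Lemma valid_walkP c :
  reflect (exists2 y : {ffun 'I_k.+1 -> bpath}, (forall j, closed (y j)) & c = walk y)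
    (valid_walk (@start q p) (@fin q p) grel c).
Proof.
apply: (iffP and3P) => [[c0 cH /forallP crel]|[y yc ->]]; last first.
  split.
  - have -> : ord0 = pos ord0 ord0 :> 'I_H.+1 by apply: ord_inj; rewrite val_pos.
    by rewrite walk_pos walk_state_start.
  - have -> : ord_max = pos ord_max ord_max :> 'I_H.+1.
      by apply: ord_inj; rewrite [RHS]val_pos.
    by rewrite walk_pos walk_state_fin.
  apply/forallP => h; have hH := ltn_ord h.
  have [j [i eh]] := posP (inord h); have vh : nat_of_ord h = pos j i.
    by rewrite -eh inordK // leqW.
  have hm : (h %% r.+1 = i)%N by rewrite vh pos_mod.
  rewrite /grel hm eh walk_pos; have [ir|ir] := eqVneq (i : nat) r.
    have jk : (j.+1 < k.+1)%N.
      rewrite ltnS ltn_neqAle -ltnS ltn_ord andbT; apply: contraTneq hH => jk.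
      by rewrite vh val_pos jk ir ltnn.
    have -> : inord h.+1 = pos (Ordinal jk) ord0 :> 'I_H.+1.
      apply: ord_inj; rewrite [RHS]val_pos /= inordK ?ltnS // vh val_pos ir addn0.
      by rewrite mulSnr addnS.
    by rewrite walk_pos walk_state_start ir walk_state_fin.
  have {}ir : (i < r)%N by rewrite ltn_neqAle ir -ltnS ltn_ord.
  have -> : inord h.+1 = pos j (Ordinal (ir : (i.+1 < r.+1)%N)) :> 'I_H.+1.
    by apply: ord_inj; rewrite [RHS]val_pos /= inordK ?ltnS // vh val_pos addnS.
  by rewrite walk_pos /=; apply: walk_state_rel.
pose C j i := c (inord (j * r.+1 + i)).
have bound j i : (j <= k)%N -> (i <= r)%N -> (j * r.+1 + i <= H)%N.
  by move=> jk ir; rewrite leq_add // leq_mul2r jk orbT.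
have rel_in j i : (j <= k)%N -> (i < r)%N -> brel m i (C j i) (C j i.+1).
  move=> jk ir; have lt : (j * r.+1 + i < H)%N by rewrite -addnS bound.
  have := crel (Ordinal lt); rewrite /grel /= modnMDl modn_small ?(leqW ir) //.
  by rewrite (ltn_eqF ir) /C addnS.
have rel_out j : (j < k)%N -> fin (C j r) && start (C j.+1 0%N).
  move=> jk; have lt : (j * r.+1 + r < H)%N.
    by apply: leq_trans (_ : j.+1 * r.+1 <= _)%N;
      [rewrite mulSnr addnS|apply: leq_trans (leq_addr _ _); rewrite leq_mul2r jk orbT].
  have := crel (Ordinal lt); rewrite /grel /= modnMDl modn_small // eqxx.
  by rewrite /C addn0 mulSnr addnS.
have C_start j : (j <= k)%N -> start (C j 0%N).
  case: j => [|j] jk; last by case/andP: (rel_out _ jk).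
  rewrite /C mul0n; have -> : inord 0 = ord0 :> 'I_H.+1 by apply/val_inj; rewrite /= inordK.
  by [].
have C_fin j : (j <= k)%N -> fin (C j r).
  rewrite leq_eqVlt => /orP[/eqP->|/rel_out/andP[] //].
  rewrite /C; have -> : inord (k * r.+1 + r) = ord_max :> 'I_H.+1.
    by apply/val_inj; rewrite /= inordK.
  by [].
have /fin_all_exists2[y yc yC] (j : 'I_k.+1) : exists2 x : bpath, closed x &
    forall i, (i <= r)%N -> C j i = walk_state m x i.
  have jk : (j <= k)%N by rewrite -ltnS.
  apply: walk_stateP => //; [exact: C_start| |exact: C_fin].
  by move=> i ir; apply: rel_in.
exists (finfun y); first by move=> j; rewrite ffunE.
apply/ffunP => h; have [j [i ->]] := posP h.
by rewrite walk_pos ffunE -yC // -ltnS ltn_ord.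
Qed.

Definition zvar : finType := ('I_r * state)%type.

Definition zemb (j : 'I_k.+1) (z : zvar) : V := (pos j (lift ord0 z.1), z.2).

Lemma zemb_inj j z j' z' : zemb j z = zemb j' z' -> j = j' /\ z = z'.
Proof.
by case: z z' => [t s] [t' s'] [/pos_inj[-> /lift_inj ->] ->].
Qed.

(** The first positions of the blocks carry the variables for the derivatives; shifts use only the
    remaining ones, block by block through [zvar]. *)
Definition ypos : {set V} := [set v : V | v.1 %% r.+1 == 0]%N.

Lemma zemb_ypos j z : zemb j z \notin ypos.
Proof. by rewrite inE pos_mod. Qed.

Definition yset (b : 'I_k.+1 -> 'I_q) : {set V} :=
  [set (pos j ord0, (b j, ord0, ord0)) | j : 'I_k.+1].

Definition glue (W : 'I_k.+1 -> {set zvar}) : {set V} :=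
  [set v : V | [exists j, [exists z, (z \in W j) && (v == zemb j z)]]].

Lemma mem_glue W j z : (zemb j z \in glue W) = (z \in W j).
Proof.
rewrite inE; apply/existsP/idP => [[j' /existsP[z' /andP[z'W /eqP/zemb_inj[-> ->]]]]//|zW].
by exists j; apply/existsP; exists z; rewrite zW eqxx.
Qed.

Lemma glueP (W : 'I_k.+1 -> {set zvar}) v : reflect (exists j z, z \in W j /\ v = zemb j z) (v \in glue W).
Proof.
rewrite inE; apply: (iffP existsP) => [[j /existsP[z /andP[zW /eqP->]]]|[j [z [zW ->]]]].
  by exists j, z.
by exists j; apply/existsP; exists z; rewrite zW eqxx.
Qed.

Lemma VP (v : V) : (exists j s, v = (pos j ord0, s)) \/ (exists j z, v = zemb j z).
Proof.
case: v => [h s]; have [j [i ->]] := posP h.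
have [i'|] := unliftP ord0 i; last by move=> ->; left; exists j, s.
by move=> ->; right; exists j, (i', s).
Qed.

Lemma yset_sub b : yset b \subset ypos.
Proof. by apply/subsetP => v /imsetP[j _ ->]; rewrite inE pos_mod. Qed.

Lemma card_yset b : (#|yset b| <= k.+1)%N.
Proof. by rewrite (leq_trans (leq_imset_card _ _)) ?card_ord. Qed.

Lemma glue_sub W : glue W \subset ~: ypos.
Proof. by apply/subsetP => v /glueP[j [z [_ ->]]]; rewrite inE zemb_ypos. Qed.

Lemma card_glue (W : 'I_k.+1 -> {set zvar}) : #|glue W| = (\sum_j #|W j|)%N.
Proof.
have -> : glue W = (fun x => zemb x.1 x.2) @: [set x : 'I_k.+1 * zvar | x.2 \in W x.1].
  apply/setP => v; apply/glueP/imsetP => [[j [z [zW ->]]]|[[j z] zW ->]].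
    by exists (j, z); rewrite ?inE.
  by exists j, z; rewrite inE in zW.
rewrite card_imset; last by move=> [j z] [j' z'] /= /zemb_inj[-> ->].
rewrite -sum1_card; under [RHS]eq_bigr => j _ do rewrite -sum1_card.
by rewrite pair_big_dep; apply: eq_bigl => x; rewrite inE.
Qed.

Lemma card_not_ypos : #|~: ypos| = (k.+1 * #|{: zvar}|)%N.
Proof.
have -> : ~: ypos = (fun x => zemb x.1 x.2) @: [set: 'I_k.+1 * zvar].
  apply/setP => v; apply/idP/imsetP => [|[[j z] _ ->]]; last by rewrite inE zemb_ypos.
  case: (VP v) => [[j [s ->]]|[j [z ->]] _]; first by rewrite !inE pos_mod.
  by exists (j, z).
rewrite card_imset; last by move=> [j z] [j' z'] /= /zemb_inj[-> ->].
by rewrite cardsT card_prod card_ord.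
Qed.

Definition trace (x : bpath) : {set zvar} := [set (t, seg_state m x t) | t : 'I_r].

Lemma mem_trace x z : (z \in trace x) = (z.2 == seg_state m x z.1).
Proof.
apply/imsetP/eqP => [[t _ ->] //|e]; exists z.1 => //.
by rewrite -e -surjective_pairing.
Qed.

Lemma graph_walk y : graph (walk y) = yset (fun j => (y j).1) :|: glue (fun j => trace (y j)).
Proof.
apply/setP => v; rewrite inE; apply/imsetP/orP => [[h _ ->]|[]].
- have [j [i ->]] := posP h; rewrite walk_pos.
  have [i'|] := unliftP ord0 i => ->; last by left; apply/imsetP; exists j.
  by right; rewrite -[X in X \in _]/(zemb j (i', _)) mem_glue mem_trace.
- by case/imsetP => j _ ->; exists (pos j ord0); rewrite ?walk_pos.
case/glueP => j [z []]; rewrite mem_trace => /eqP e ->.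
by exists (pos j (lift ord0 z.1)); rewrite // walk_pos /zemb e.
Qed.

Lemma graph_eqP y (b : 'I_k.+1 -> 'I_q) (W : 'I_k.+1 -> {set zvar}) :
  reflect (forall j, (y j).1 = b j /\ trace (y j) = W j)
    (yset b :|: glue W == graph (walk y)).
Proof.
rewrite graph_walk; apply: (iffP eqP) => [e j|e]; last first.
  congr (_ :|: _).
    by apply/setP => v; apply/imsetP/imsetP => -[j _ ->]; exists j; rewrite ?(e j).1.
  by apply/setP => v; apply/glueP/glueP => -[j [z [zW ->]]]; exists j, z; rewrite (e j).2 in zW *.
split.
  have : (pos j ord0, (b j, ord0, ord0)) \in yset b :|: glue W.
    by rewrite inE; apply/orP; left; apply/imsetP; exists j.
  rewrite e inE => /orP[/imsetP[j' _ [/pos_inj[-> _] ->]]//|].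
  by case/glueP => j' [z [_ []]] /pos_inj[_].
apply/setP => z; have /setP/(_ (zemb j z)) := e; rewrite !in_setU.
have ny b' : (zemb j z \in yset b') = false.
  by apply/negP => /(subsetP (yset_sub b')); rewrite (negPf (zemb_ypos j z)).
by rewrite !ny /= !mem_glue => ->.
Qed.

End GlobalWalks.

(** * Isolated shifts *)

Section Isolation.

Variables (F : fieldType) (q p m R k : nat).
Hypotheses (m_gt0 : (0 < m)%N) (R_gt0 : (0 < R)%N).

Local Notation r := (blen m R).
Local Notation state := (state q p).
Local Notation bpath := (bpath q p R).
Local Notation H := (k * r.+1 + r)%N.
Local Notation V := ('I_H.+1 * state)%type.
Local Notation zvar := (zvar q p m R).

Definition btriple : finType := (bpath * {set zvar})%type.

(* The full set e.2 :|: trace e.1 determines e, and e.2 determines e among the walks from the same source. *)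
Definition isolated : {set btriple} :=
  [set e : btriple | [&& closed e.1, [disjoint trace m e.1 & e.2] &
    [forall y : bpath, (closed y && (y != e.1)) ==>
       ((y.1 == e.1.1) ==> ~~ [disjoint trace m y & e.2]) &&
       ~~ (trace m y \subset e.2 :|: trace m e.1)]]].

Variable f : sqf F V.
Hypothesis fE : forall A, f A =
  [exists c, valid_walk (@start q p) (@fin q p) (grel m R) c && (A == graph c)]%:R.

Implicit Types w : {ffun 'I_k.+1 -> btriple}.

Definition shift_set w : {set V} := @glue q p m R k (fun j => (w j).2).
Definition full_set w : {set V} := glue (fun j => (w j).2 :|: trace m (w j).1).
Definition row_yset w : {set V} := yset p m R (fun j => (w j).1.1).

Lemma glueD (W W' : 'I_k.+1 -> {set zvar}) :
  glue W :\: glue W' = glue (fun j => W j :\: W' j).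
Proof.
apply/setP => v; case: (VP v) => [[j [s ->]]|[j [z ->]]].
  have ny (W1 : 'I_k.+1 -> {set zvar}) : ((pos j ord0, s) \in glue W1) = false.
    by apply/negP => /glueP[j' [z [_ []]]] /pos_inj[_].
  by rewrite inE !ny andbF.
by rewrite inE !mem_glue inE.
Qed.

Lemma glue_subset (W W' : 'I_k.+1 -> {set zvar}) :
  reflect (forall j, W j \subset W' j) (glue W \subset glue W').
Proof.
apply: (iffP subsetP) => [sub j|sub v /glueP[j [z [zW ->]]]]; last first.
  by rewrite mem_glue (subsetP (sub j)).
by apply/subsetP => z zW; have := sub (zemb j z); rewrite !mem_glue => ->.
Qed.

(** A nonzero entry yields a walk [y] with the sources of [w] that avoids the shift of [w] and lies
    inside the full set of [w']. The two halves of isolation identify it with the walks of [w] and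
    of [w']. *)
Lemma isolated_entries w w' :
    (forall j, w j \in isolated) -> (forall j, w' j \in isolated) ->
  (if shift_set w \subset full_set w' then
     f (row_yset w :|: (full_set w' :\: shift_set w)) else 0) = (w == w')%:R.
Proof.
move=> iw iw'; rewrite /shift_set /full_set /row_yset glueD.
have diag j :
    ((w j).2 :|: trace m (w j).1) :\: (w j).2 = trace m (w j).1.
  have := iw j; rewrite inE => /and3P[_ dis _].
  by rewrite setDUl setDv set0U; apply/setDidPl.
have [ew|ne] := eqVneq w w'.
  rewrite -ew; case: glue_subset => [_|[]]; last by move=> j; apply: subsetUl.
  rewrite fE; apply/eqP; rewrite (_ : [exists c, _] = true) //.
  apply/existsP; exists (walk m [ffun j => (w j).1]); apply/andP; split.
    apply/(valid_walkP m_gt0 R_gt0); exists [ffun j => (w j).1] => // j.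
    by rewrite ffunE; have := iw j; rewrite inE => /and3P[].
  by apply/graph_eqP => j; rewrite ffunE diag.
case: glue_subset => // sub; rewrite fE; apply/eqP; rewrite (_ : [exists c, _] = false) //.
apply/negbTE/existsP => -[c /andP[/(valid_walkP m_gt0 R_gt0)[y yc ->] /graph_eqP gy]].
case/eqP: ne; apply/ffunP => j; have [yb ytr] := gy j; have yjc := yc j.
have := iw j; rewrite inE => /and3P[cw dw /forallP nw].
have := iw' j; rewrite inE => /and3P[cw' dw' /forallP nw'].
(* First half: no other walk from the same source avoids the shift of [w j]. *)
have ey : y j = (w j).1.
  apply: contraTeq isT => ney; have := nw (y j); rewrite yjc ney yb eqxx /=.
  case/andP=> /negP[]; rewrite ytr.
  by apply/pred0P => z; rewrite /= !inE; case: (z \in (w j).2); rewrite ?andbF.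
rewrite ey in ytr.
(* Second half: no other walk lies inside the full set of [w' j]. *)
have ew : (w j).1 = (w' j).1.
  apply: contraTeq isT => new; have := nw' (w j).1; rewrite cw new /=.
  by case/andP=> _ /negP[]; rewrite ytr subsetDl.
rewrite [w j]surjective_pairing [w' j]surjective_pairing ew; congr pair.
(* With equal walks, removing either shift from the full set of [w' j] leaves the same trace, so the
   shifts agree. *)
have e1 : trace m (w' j).1 = ((w' j).2 :|: trace m (w' j).1) :\: (w j).2 by rewrite -ytr ew.
have sj := sub j; apply/setP => z.
move/setP/(_ z): e1; rewrite !inE.
have := subsetP sj z; rewrite inE.
have dz' := pred0P dw' z; have dz := pred0P dw z; rewrite /= ?ew in dz dz' *.
move: dz dz'; case: (z \in trace m _); case: (z \in (w j).2);
  case: (z \in (w' j).2) => //= _ _ /(_ isT) //.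
Qed.

Theorem card_isolated_le (T n s l : nat) (c : 'I_T -> F) (g : 'I_T -> 'I_n -> sqf F V) :
    (forall i a A, g i a A != 0 -> (#|A| <= s)%N) ->
    f = \sum_i sqf_const V (c i) * \prod_a g i a ->
  (#|[set w : {ffun 'I_k.+1 -> btriple} | [forall j, w j \in isolated] && (\sum_j #|(w j).2| == l)]|
   <= T * #|[set J : {set 'I_n} | (#|J| <= k.+1)%N]|
      * #|[set A : {set V} | [&& A \subset ~: ypos q p m R k, l <= #|A| & #|A| <= l + k.+1 * s]]|)%N.
Proof.
move=> g_deg f_dec.
apply: (@card_shifted_partials F V _ (ypos q p m R k) T n k.+1 s l c g _
   row_yset shift_set full_set g_deg).
- by move=> w; split; [apply: yset_sub|apply: card_yset].
- by move=> w; apply: glue_sub.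
- by move=> w; rewrite inE => /andP[_ /eqP <-]; rewrite /shift_set card_glue.
move=> w w'; rewrite !inE => /andP[/forallP iw _] /andP[/forallP iw' _].
rewrite -isolated_entries //; case: ifP => // _.
by rewrite f_dec sqf_sum; apply: eq_bigr => i _; rewrite sqf_mul_const.
Qed.

End Isolation.

(** * Weighted counts *)

Section SetWeights.

Variables (K : realFieldType) (Z : finType) (x : K).
Hypothesis x_gt0 : 0 < x.

(** The elements are independent: one of [A] contributes [x], one of [B] contributes 1, any other
    [1 + x]. *)
Lemma sum_set_weights (A B : {set Z}) : [disjoint A & B] ->
  \sum_(S : {set Z} | (A \subset S) && [disjoint B & S]) x ^+ #|S| =
  x ^+ #|A| * (1 + x) ^+ #|Z| / (1 + x) ^+ (#|A| + #|B|).
Proof.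
move=> dAB.
pose f v := if v \in B then 0 else x.
pose g v := if v \in A then 0 else 1 : K.
transitivity (\prod_v (f v + g v)).
  rewrite bigA_distr big_mkcond /=; apply: eq_bigr => S _.
  case: ifPn => [/andP[AS dBS]|].
    rewrite -prodr_const big_mkcond /=; apply: eq_bigr => v _; rewrite /f /g.
    case: ifPn => vS; first by rewrite (disjointFl dBS vS).
    by case: ifPn => // vA; rewrite (subsetP AS) in vS.
  rewrite negb_and => /orP[/subsetPn[v vA vS]|].
    by rewrite (bigD1 v) //= (negPf vS) /g vA mul0r.
  move=> /pred0Pn[v /andP[/= vB vS]].
  by rewrite (bigD1 v) //= vS /f vB mul0r.
have nz : 1 + x != 0 by rewrite gt_eqF // addr_gt0.
have e v : f v + g v = (1 + x) * ((if v \in A then x / (1 + x) else 1) *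
    (if v \in B then (1 + x)^-1 else 1)).
  rewrite /f /g; case: ifPn => vB; first by rewrite (disjointFl dAB vB) add0r mul1r mulfV.
  case: ifPn => _; last by rewrite !mulr1 addrC.
  by rewrite addr0 mulr1 mulrC divfK.
under eq_bigr => v _ do rewrite e.
rewrite !big_split /= -!big_mkcond /= !prodr_const expr_div_n exprVn.
rewrite exprD invfM mulrA (_ : #|(_ : pred Z)| = #|Z|) //.
by rewrite [_ * (x ^+ _ / _)]mulrCA !mulrA.
Qed.

End SetWeights.

Lemma prod_divn (K : comNzRingType) (R m : nat) (f : nat -> K) : (0 < m)%N ->
  \prod_(t < R * m) f (t %/ m)%N = \prod_(i < R) f i ^+ m.
Proof.
move=> m_gt0; elim: R => [|R IH]; first by rewrite mul0n !big_ord0.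
rewrite big_ord_recr -IH mulSnr big_split_ord /=; congr (_ * _).
rewrite (eq_bigr (fun=> f R)) ?prodr_const ?card_ord // => i _.
by rewrite divnMDl // divn_small ?addn0.
Qed.

(** * Counting paths by their distance from a given path *)

Section PathPotential.

Variables (K : realFieldType) (p R : nat) (eta e : K).
Hypotheses (e_ge0 : 0 <= e) (eta_e : eta = e ^+ 2) (p_eta : p.+1%:R * eta <= 1).
Variable c : {ffun 'I_R.+1 -> 'I_p.+1}.
Hypotheses (c0 : c ord0 = ord0) (cR : c ord_max = ord0).

Let step i (u v : 'I_p.+1) : K :=
  if (u == c (inord i)) && (v == c (inord i.+1)) then 1 else eta.
Let h := walk_sum (fun a : 'I_p.+1 => (a == ord0)%:R : K) step.

(* The weight of the paths now on c plus e times the weight of the paths now off c grows by a factor of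
   at most 1 + e per segment: returning to c or leaving it costs eta = e^2, and so does every segment off c, but there
   the number p of possible next vertices makes up for it. *)
Lemma path_potential i : (i <= R)%N ->
  (forall v, 0 <= h i v) /\
  h i (c (inord i)) + e * (\sum_(v | v != c (inord i)) h i v) <= (1 + e) ^+ i.
Proof.
have eta_ge0 : 0 <= eta by rewrite eta_e sqr_ge0.
have step_ge0 j u v : 0 <= step j u v by rewrite /step; case: ifP.
elim: i => [|i IH] iR.
  split=> [v|]; first by rewrite /h /= ler0n.
  have -> : inord 0 = ord0 :> 'I_R.+1 by apply/val_inj; rewrite /= inordK.
  by rewrite c0 /h /= big1 ?mulr0 ?addr0 // => v /negPf->.
have [hge0 IHi] := IH (ltnW iR).
split=> [v|]; first by rewrite /h /=; apply: sumr_ge0 => u _; rewrite mulr_ge0.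
set X := h i _ in IHi; set Y := \sum_(v | v != _) h i v in IHi.
have Y_ge0 : 0 <= Y by apply: sumr_ge0.
have X_ge0 : 0 <= X by apply: hge0.
have -> : h i.+1 (c (inord i.+1)) = X + eta * Y.
  rewrite /h /= (bigD1 (c (inord i))) //= -/h {1}/step !eqxx mulr1 mulr_sumr.
  by congr (_ + _); apply: eq_bigr => u ne; rewrite /step (negPf ne) mulrC.
have -> : \sum_(v | v != c (inord i.+1)) h i.+1 v = p%:R * eta * (X + Y).
  transitivity (\sum_(v | v != c (inord i.+1)) eta * (X + Y)).
    have -> : X + Y = \sum_u h i u by rewrite [RHS](bigD1 (c (inord i))).
    apply: eq_bigr => v ne; rewrite mulr_sumr.
    by apply: eq_bigr => u _; rewrite /step (negPf ne) andbF mulrC.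
  rewrite sumr_const (_ : #|_| = p); last first.
    have := cardC1 (c (inord i.+1)); rewrite card_ord /= => ep; rewrite -[RHS]ep.
    by apply: eq_card => v; rewrite !inE.
  by rewrite -[_ *+ p]mulr_natl mulrA.
have le1 : p%:R * eta * (X + Y) <= X + Y.
  rewrite ler_piMl ?addr_ge0 //; apply: le_trans p_eta.
  by rewrite ler_wpM2r // ler_nat.
apply: le_trans (_ : (1 + e) * (X + e * Y) <= _); last first.
  by rewrite exprS ler_wpM2l // addr_ge0.
(* Bounding [p * eta] by 1 leaves [X + e^2 Y + e (X + Y)], which is exactly [(1 + e) (X + e Y)]. *)
have := ler_wpM2l e_ge0 le1; rewrite eta_e; nra.
Qed.

(** Each segment that differs from [c] costs [eta]. As [c] ends at [ord0], the sum is the on-path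
    term of the potential at [R]. *)
Lemma sum_closed_paths_le :
  \sum_(d : {ffun 'I_R.+1 -> 'I_p.+1} | (d ord0 == ord0) && (d ord_max == ord0))
    \prod_(i < R) (if (d (inord i), d (inord i.+1)) == (c (inord i), c (inord i.+1))
                   then 1 else eta) <= (1 + e) ^+ R.
Proof.
have -> : \sum_(d : {ffun 'I_R.+1 -> 'I_p.+1} | (d ord0 == ord0) && (d ord_max == ord0))
    \prod_(i < R) (if (d (inord i), d (inord i.+1)) == (c (inord i), c (inord i.+1))
                   then 1 else eta) = h R (c (inord R)).
  have -> : inord R = ord_max :> 'I_R.+1 by apply/val_inj; rewrite /= inordK.
  transitivity (\sum_a h R a * (a == ord0)%:R).
    rewrite walk_sumE big_mkcond; apply: eq_bigr => d _ /=.
    have -> : \prod_(i < R) (if (d (inord i), d (inord i.+1)) ==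
       (c (inord i), c (inord i.+1)) then 1 else eta) =
       \prod_(i < R) step i (d (inord i)) (d (inord i.+1)).
      by apply: eq_bigr => i _; rewrite xpair_eqE.
    by case: (d ord0 == _); case: (d ord_max == _); rewrite /= ?mul1r ?mulr1 ?mulr0 ?mul0r.
  rewrite (bigD1 ord0) //= mulr1 big1 ?addr0 ?cR // => a /negPf->.
  by rewrite mulr0.
have [hge0 le] := path_potential (leqnn R); apply: le_trans le.
by rewrite lerDl mulr_ge0 // sumr_ge0.
Qed.

End PathPotential.

(** The [R.-1] inner vertices are free; counted as a walk sum with all step weights 1. *)
Lemma card_closed_paths (p R : nat) : (0 < R)%N ->
  #|[set d : {ffun 'I_R.+1 -> 'I_p.+1} | (d ord0 == ord0) && (d ord_max == ord0)]|
  = (p.+1 ^ R.-1)%N.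
Proof.
case: R => // R _; apply/eqP; rewrite -(eqr_nat rat); apply/eqP.
pose g (a : 'I_p.+1) : rat := (a == ord0)%:R.
have ws h a : walk_sum g (fun _ _ _ => 1) h.+1 a = (p.+1 ^ h)%:R.
  elim: h a => [|h IH] a /=.
    rewrite (bigD1 ord0) //= {1}/g eqxx mulr1 big1 ?addr0 // => b /negPf b0.
    by rewrite /g b0 mul0r.
  under eq_bigr => b _ do rewrite -[X in X * _]/(walk_sum g (fun _ _ _ => 1) h.+1 b) IH mulr1.
  by rewrite sumr_const card_ord -mulrnA expnSr.
have := walk_sumE g (fun _ _ _ => 1) R.+1 g.
rewrite (bigD1 ord0) //= -[X in X * _]/(walk_sum g (fun _ _ _ => 1) R.+1 ord0) ws.
rewrite {1}/g eqxx mulr1 big1 ?addr0 => [->|b /negPf b0]; last by rewrite /g b0 mulr0.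
rewrite -sum1_card natr_sum big_mkcond; apply: eq_bigr => d _.
rewrite inE prodr_const expr1n mulr1 /g.
by case: (d ord0 == _); case: (d ord_max == _); rewrite /= ?mulr1 ?mulr0 ?mul0r.
Qed.

(** * First-moment bound for the isolated pairs of one block *)

Section BlockWeight.

Variables (K : realFieldType) (q p m R : nat) (x e : K).
Hypotheses (m_gt0 : (0 < m)%N) (R_gt0 : (0 < R)%N).

Local Notation r := (blen m R).
Local Notation bpath := (bpath q p R).
Local Notation zvar := (zvar q p m R).
Local Notation phi := ((1 + x)^-1).
Implicit Types (y z : bpath) (S : {set zvar}).

Definition block_weight : K := \sum_(t in isolated q p m R) x ^+ #|t.2|.

Hypotheses (x_gt0 : 0 < x) (x_le1 : x <= 1) (e_ge0 : 0 <= e).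
Hypothesis phi_m : phi ^+ m = e ^+ 2.
Hypothesis p_small : p.+1%:R * phi ^+ m <= 1.
Hypothesis e_small : (1 + e) ^+ R <= 9 / 8.
Hypothesis q_small : (q * p.+1 ^ R.-1)%:R * (x * phi) ^+ r <= 4^-1.

Let Cl : {set bpath} := [set y | closed y].
Let diff y z := #|trace m z :\: trace m y|.

Lemma card_closed : #|Cl| = (q * p.+1 ^ R.-1)%N.
Proof.
rewrite -(card_closed_paths p R_gt0) -[q in RHS]card_ord -cardsT -cardsX.
by apply: eq_card => y; rewrite !inE.
Qed.

Lemma card_trace y : #|trace m y| = r.
Proof. by rewrite card_imset ?card_ord // => s t []. Qed.

Lemma diff_prod (f : K) y z : f ^+ diff y z =
  \prod_(t < r) (if seg_state m z t == seg_state m y t then 1 else f).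
Proof.
have -> : diff y z = #|[pred t : 'I_r | seg_state m z t != seg_state m y t]|.
  rewrite /diff -(card_imset _ (_ : injective (fun t : 'I_r => (t, seg_state m z t)))).
    apply: eq_card => v; rewrite inE !mem_trace; apply/andP/imsetP.
      case=> ne /eqP ez; exists v.1; last by rewrite -ez -surjective_pairing.
      by rewrite inE -ez.
    by case=> t; rewrite inE => ne -> /=.
  by move=> s t [].
rewrite -prodr_const big_mkcond; apply: eq_bigr => t _.
by rewrite inE; case: eqP.
Qed.

Lemma diff_other_source (f : K) y z : z.1 != y.1 -> f ^+ diff y z = f ^+ r.
Proof.
move=> ne; rewrite diff_prod -[in RHS](card_ord r) -prodr_const; apply: eq_bigr => t _.
by case: eqP => // -[e1]; rewrite e1 eqxx in ne.
Qed.

Let phi_gt0 : 0 < phi. Proof. by rewrite invr_gt0 addr_gt0. Qed.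

(** A segment off [y] costs [phi ^+ m = e ^+ 2], so the sum including [z = y] is at most
    [(1 + e) ^+ R], hence at most 9/8; the term of [y] itself is 1. *)
Lemma sum_same_source y : closed y ->
  \sum_(z in Cl | (z != y) && (z.1 == y.1)) phi ^+ diff y z <= 8^-1.
Proof.
case: y => b c yc; have /andP[/eqP c0 /eqP cR] := yc.
have := sum_closed_paths_le e_ge0 (erefl : e ^+ 2 = e ^+ 2) (_ : p.+1%:R * e ^+ 2 <= 1) c0 cR.
rewrite -{1}phi_m => /(_ p_small) le.
have eq_sum : \sum_(z in Cl | z.1 == b) phi ^+ diff (b, c) z =
  \sum_(d : {ffun 'I_R.+1 -> 'I_p.+1} | (d ord0 == ord0) && (d ord_max == ord0))
    \prod_(i < R) (if (d (inord i), d (inord i.+1)) == (c (inord i), c (inord i.+1))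
                   then 1 else e ^+ 2).
  rewrite (reindex_onto (fun d => (b, d)) (fun z => z.2)) /=; last first.
    by move=> [b' d] /andP[_ /= /eqP->].
  apply: eq_big => [d|d _]; first by rewrite inE /closed /= !eqxx !andbT.
  rewrite diff_prod -phi_m.
  pose f i := if (d (inord i), d (inord i.+1)) == (c (inord i), c (inord i.+1))
              then 1 else phi.
  transitivity (\prod_(i < R) f i ^+ m); last first.
    by apply: eq_bigr => i _; rewrite /f; case: ifP; rewrite ?expr1n.
  rewrite -prod_divn //; apply: eq_bigr => t _.
  by rewrite /f /seg_state !xpair_eqE eqxx.
move: le; rewrite -eq_sum (bigD1 (b, c)) /=; last by rewrite inE yc eqxx.
rewrite diff_prod big1 => [le|t _]; last by rewrite eqxx.
rewrite (eq_bigl (fun z => (z \in Cl) && (z.1 == b) && (z != (b, c)))); last first.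
  by move=> z; rewrite andbAC andbA.
by have := le_trans le e_small; lra.
Qed.

(** Every variable of [z] outside [y] has to lie in the shift, at a relative cost of [x * phi].
    Walks in the same copy are covered by the previous sum; in other copies all [r] variables differ
    and [q_small] applies. *)
Lemma sum_backward y : closed y ->
  \sum_(z in Cl | z != y) (x * phi) ^+ diff y z <= 8^-1 + 4^-1.
Proof.
move=> yc; rewrite (bigID (fun z : bpath => z.1 == y.1)) /=; apply: lerD.
  rewrite (eq_bigl (fun z => (z \in Cl) && ((z != y) && (z.1 == y.1)))); last first.
    by move=> z; rewrite andbA.
  apply: le_trans (sum_same_source yc); apply: ler_sum => z _.
  have [x_ge0 phi_ge0] := (ltW x_gt0, ltW phi_gt0).
  by apply: lerXn2r; rewrite ?nnegrE ?mulr_ge0 ?ler_piMl.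
apply: le_trans q_small; rewrite -card_closed.
apply: le_trans (_ : \sum_(z in Cl) (x * phi) ^+ r <= _); last first.
  by rewrite sumr_const mulr_natl.
rewrite [leRHS]big_mkcond [leLHS]big_mkcond /=; apply: ler_sum => z _.
case: ifPn => [/andP[/andP[-> _] /diff_other_source->] //|_].
by case: ifP => // _; rewrite exprn_ge0 // mulr_ge0 // ltW.
Qed.

Let disj_weight : {set zvar} -> K := fun T => \sum_(S : {set zvar} | [disjoint T & S]) x ^+ #|S|.

Lemma disj_weightE T : disj_weight T = (1 + x) ^+ #|zvar| * phi ^+ #|T|.
Proof.
have := @sum_set_weights K _ x x_gt0 set0 T; rewrite cards0 expr0 mul1r add0n -exprVn.
move=> <-; first by apply: eq_bigl => S; rewrite sub0set.
by rewrite -setI_eq0 set0I.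
Qed.

(** The indicator of isolation is at least 1 minus the number of competitors of either kind; on
    average this leaves [1 - 1/8 - (1/8 + 1/4) = 1/2]. *)
Lemma block_weight_ge :
  (1 + x) ^+ #|zvar| * (q * p.+1 ^ R.-1)%:R * phi ^+ r / 2 <= block_weight.
Proof.
pose fwd y S : K := \sum_(z in Cl | (z != y) && (z.1 == y.1)) [disjoint trace m z & S]%:R.
pose bwd y S : K := \sum_(z in Cl | z != y) (trace m z \subset S :|: trace m y)%:R.
have fwd_ge0 y S : 0 <= fwd y S by apply: sumr_ge0 => z _; rewrite ler0n.
have bwd_ge0 y S : 0 <= bwd y S by apply: sumr_ge0 => z _; rewrite ler0n.
apply: (@le_trans _ _ (\sum_(y in Cl) \sum_(S : {set zvar} | [disjoint trace m y & S])
    x ^+ #|S| * (1 - fwd y S - bwd y S))); last first.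
  (* A pair with a competitor has [1 - fwd - bwd <= 0]; for the others the factor is at most 1. *)
  rewrite pair_big_dep /= [leLHS]big_mkcond /block_weight [leRHS]big_mkcond /=.
  apply: ler_sum => -[y S] _ /=.
  have xS : 0 <= x ^+ #|S| by rewrite exprn_ge0 // ltW.
  case: ifPn => [/andP[yc dis]|]; last by case: ifP.
  case: ifPn => [_|].
    by rewrite ler_piMr // -addrA gerDl -opprD oppr_le0 addr_ge0.
  rewrite inE in yc; rewrite inE /= yc dis /= => /forallPn[z].
  rewrite negb_imply negb_and negb_imply !negbK => /andP[/andP[zc ne] bad].
  rewrite mulr_ge0_le0 //; case/orP: bad => [/andP[zb zd]|zsub].
    have ge1 : 1 <= fwd y S.
      rewrite /fwd (bigD1 z) /=; last by rewrite inE zc ne zb.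
      by rewrite zd lerDl sumr_ge0 // => ? _; rewrite ler0n.
    by rewrite -addrA -opprD subr_le0 (le_trans ge1) // lerDl.
  have ge1 : 1 <= bwd y S.
    rewrite /bwd (bigD1 z) /=; last by rewrite inE zc ne.
    by rewrite zsub lerDl sumr_ge0 // => ? _; rewrite ler0n.
  by rewrite -addrA -opprD subr_le0 (le_trans ge1) // lerDr.
pose M := (1 + x) ^+ #|zvar| * phi ^+ r.
have M_ge0 : 0 <= M by rewrite mulr_ge0 // exprn_ge0 ?addr_ge0 // ltW // ltr_pwDr.
apply: (@le_trans _ _ (\sum_(y in Cl) M / 2)).
  rewrite sumr_const card_closed -[leRHS]mulr_natl /M.
  by rewrite mulrA mulrA [X in _ <= X * _ * _]mulrC.
apply: ler_sum => y; rewrite inE => yc.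
under eq_bigr => S _ do rewrite !mulrBr mulr1 /fwd /bwd !mulr_sumr.
rewrite !sumrB -/(disj_weight _) disj_weightE card_trace -/M.
rewrite exchange_big [X in _ - X]exchange_big /=.
have natM (P Q : pred {set zvar}) : \sum_(S | P S) x ^+ #|S| * (Q S)%:R =
    \sum_(S | P S && Q S) x ^+ #|S|.
  rewrite big_mkcondr; apply: eq_bigr => S _.
  by case: (Q S); rewrite ?mulr1 ?mulr0.
have cardU z : #|trace m y :|: trace m z| = (r + diff y z)%N.
  rewrite -(card_trace y) -cardsUI (_ : _ :&: (_ :\: _) = set0) ?cards0 ?addn0.
    by congr #|pred_of_set _|; apply/setP => v; rewrite !inE; case: (v \in trace m y).
  by apply/setP => v; rewrite !inE; case: (v \in trace m y).
have fwdE z : \sum_(S : {set zvar} | [disjoint trace m y & S])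
    x ^+ #|S| * [disjoint trace m z & S]%:R = M * phi ^+ diff y z.
  rewrite natM /M -mulrA -exprD -cardU -disj_weightE; apply: eq_bigl => S.
  by rewrite -!setI_eq0 setIUl setU_eq0.
have bwdE z : \sum_(S : {set zvar} | [disjoint trace m y & S])
    x ^+ #|S| * (trace m z \subset S :|: trace m y)%:R = M * (x * phi) ^+ diff y z.
  have dis : [disjoint trace m z :\: trace m y & trace m y].
    by rewrite -setI_eq0; apply/eqP/setP => v; rewrite !inE andbAC andNb.
  rewrite natM -(eq_bigl _ _ (_ : (fun S => (trace m z :\: trace m y \subset S) &&
      [disjoint trace m y & S]) =1 _)); last by move=> S; rewrite subDset setUC andbC.
  rewrite sum_set_weights // card_trace exprD invfM -!exprVn exprMn /M -/(diff y z).
  move: (x ^+ _) (phi ^+ diff y z) (phi ^+ r) ((1 + x) ^+ _) => a b c d.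
  by rewrite [a * d]mulrC [b * c]mulrC mulrACA.
under eq_bigr => z _ do rewrite fwdE.
under [X in _ - X]eq_bigr => z _ do rewrite bwdE.
rewrite -!mulr_sumr -[X in X - _ - _]mulr1 -!mulrBr ler_wpM2l //.
have := sum_same_source yc; have := sum_backward yc; lra.
Qed.

End BlockWeight.

(** * Combining the blocks and the shift sizes *)

(** A set with at most [k] elements is the set of values of a [k]-tuple in which some entries may be
    [None]. *)
Lemma card_small_subsets (n k : nat) :
  (#|[set J : {set 'I_n} | (#|J| <= k)%N]| <= n.+1 ^ k)%N.
Proof.
pose im (h : {ffun 'I_k -> option 'I_n}) := [set i | Some i \in codom h].
have -> : (n.+1 ^ k = #|{ffun 'I_k -> option 'I_n}|)%N.
  by rewrite card_ffun card_option !card_ord.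
rewrite -[leqRHS]cardsT; apply: leq_trans (leq_imset_card im _).
apply/subset_leq_card/subsetP => J; rewrite inE => Jk.
apply/imsetP; exists [ffun j : 'I_k => nth None (map Some (enum J)) j] => //.
apply/setP => i; rewrite inE; apply/idP/codomP => [iJ|[j]].
  have ij : (index i (enum J) < k)%N.
    by apply: leq_trans Jk; rewrite cardE index_mem mem_enum.
  exists (Ordinal ij); rewrite ffunE (nth_map i) ?index_mem ?mem_enum //=.
  by rewrite nth_index ?mem_enum.
rewrite ffunE; have [lt|ge] := ltnP j (size (enum J)).
  by rewrite (nth_map i) // => -[->]; rewrite -mem_enum mem_nth.
by rewrite nth_default ?size_map.
Qed.

(** After exchanging the sums, each [A] lies in at most [E.+1] windows, and there
    [x ^+ (E + l) <= x ^+ #|A|] because [x <= 1]. *)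
Lemma sum_window_weights (K : realFieldType) (V : finType) (x : K) (B : {set V}) (M E : nat) :
    0 < x -> x <= 1 ->
  x ^+ E * (\sum_(l < M) x ^+ l *
     #|[set A : {set V} | [&& A \subset ~: B, l <= #|A| & #|A| <= l + E]%N]|%:R)
  <= E.+1%:R * (1 + x) ^+ #|~: B|.
Proof.
move=> x_gt0 x_le1; have x_ge0 := ltW x_gt0.
have -> : (1 + x) ^+ #|~: B| = \sum_(A : {set V} | A \subset ~: B) x ^+ #|A|.
  have := @sum_set_weights K V x x_gt0 set0 B; rewrite cards0 expr0 mul1r add0n.
  rewrite -(cardsC B) exprD [_ * (1 + x) ^+ _]mulrC mulfK; last first.
    by rewrite expf_neq0 // gt_eqF // addr_gt0.
  move=> <-; last by rewrite -setI_eq0 set0I.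
  by apply: eq_bigl => A; rewrite sub0set subsetC subsets_disjoint setCK disjoint_sym.
rewrite !mulr_sumr.
under eq_bigr => l _.
  rewrite mulrA -exprD -sum1_card natr_sum mulr_sumr.
  under eq_bigl => A do rewrite inE.
  rewrite big_mkcondr /=; over.
rewrite exchange_big /=; apply: ler_sum => A _.
rewrite -big_mkcond /=.
apply: le_trans (_ : \sum_(l < M | (l <= #|A| <= l + E)%N) x ^+ #|A| <= _).
  apply: ler_sum => l /andP[_ Al]; rewrite mulr1.
  by rewrite ler_wiXn2l // addnC.
rewrite sumr_const -[leLHS]mulr_natl ler_wpM2r ?exprn_ge0 // ler_nat.
have := subset_leq_card (_ : [set l : 'I_M | (l <= #|A| <= l + E)%N] \subset
   [set l : 'I_M | (#|A| - E <= l < #|A|.+1)%N]).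
rewrite !cardsE => /(_ _) le; apply: leq_trans (le _) _.
  apply/subsetP => l; rewrite !inE => /andP[l1 l2].
  by rewrite leq_subLR addnC l2 ltnS.
rewrite -(size_iota (#|A| - E) E.+1).
rewrite cardE -(size_map (val : 'I_M -> nat)); apply: uniq_leq_size.
  by rewrite map_inj_uniq ?enum_uniq //; apply: val_inj.
move=> i /mapP[l]; rewrite mem_enum => /andP[l1 l2] ->.
rewrite mem_iota addnS ltnS; apply/andP; split; first exact: l1.
by apply: (@leq_trans #|A|); [rewrite -ltnS|rewrite addnC -leq_subLR].
Qed.

Section Combination.

Variables (K : realFieldType) (F : fieldType) (q p m R k : nat) (x : K).
Hypotheses (m_gt0 : (0 < m)%N) (R_gt0 : (0 < R)%N) (x_gt0 : 0 < x) (x_le1 : x <= 1).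

Local Notation r := (blen m R).
Local Notation state := (state q p).
Local Notation H := (k * r.+1 + r)%N.
Local Notation V := ('I_H.+1 * state)%type.
Local Notation zvar := (zvar q p m R).
Local Notation btriple := (btriple q p m R).
Local Notation M := (k.+1 * #|{: zvar}|)%N.

(** Blocks are independent, so the power expands into families of isolated pairs, sorted by total
    shift size. *)
Lemma block_weight_exp :
  \sum_(l < M.+1) x ^+ l * #|[set w : {ffun 'I_k.+1 -> btriple} |
     [forall j, w j \in isolated q p m R] && (\sum_j #|(w j).2| == l)%N]|%:R
  = block_weight q p m R x ^+ k.+1.
Proof.
have wM (w : {ffun 'I_k.+1 -> btriple}) : (\sum_j #|(w j).2| < M.+1)%N.
  rewrite ltnS -[k.+1 in leqRHS]card_ord -sum_nat_const.
  by apply: leq_sum => j _; apply: max_card.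
rewrite /block_weight -[k.+1 in RHS]card_ord -prodr_const bigA_distr_big /=.
rewrite [RHS](partition_big (fun w => Ordinal (wM w)) xpredT) //=.
apply: eq_bigr => l _; rewrite -[X in _ * X%:R]sum1_card natr_sum mulr_sumr.
apply: eq_big => [w|w]; rewrite inE.
  by congr (_ && _); apply/forallP/ffun_onP.
by case/andP=> _ /eqP <-; rewrite mulr1 prodrXr.
Qed.

Variable f : sqf F V.
Hypothesis fE : forall A, f A =
  [exists c, valid_walk (@start q p) (@fin q p) (grel m R) c && (A == graph c)]%:R.

(** Sums the rank bound over all shift sizes [l] with weight [x ^+ l], so that no particular [l] has
    to be singled out. *)
Theorem block_weight_exp_le (T n s : nat) (c : 'I_T -> F) (g : 'I_T -> 'I_n -> sqf F V) :
    (forall i a A, g i a A != 0 -> (#|A| <= s)%N) ->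
    f = \sum_i sqf_const V (c i) * \prod_a g i a ->
  x ^+ (k.+1 * s) * block_weight q p m R x ^+ k.+1 <=
  T%:R * (n.+1 ^ k.+1)%:R * (k.+1 * s).+1%:R * (1 + x) ^+ M.
Proof.
move=> g_deg f_dec; have x_ge0 := ltW x_gt0.
rewrite -block_weight_exp -[X in _ * (1 + x) ^+ X](card_not_ypos q p m R k).
apply: le_trans (_ : T%:R * (n.+1 ^ k.+1)%:R * (x ^+ (k.+1 * s) * (\sum_(l < M.+1) x ^+ l *
     #|[set A : {set V} | [&& A \subset ~: ypos q p m R k, l <= #|A|
        & #|A| <= l + k.+1 * s]%N]|%:R)) <= _).
  rewrite mulrCA ler_wpM2l ?exprn_ge0 // mulr_sumr; apply: ler_sum => l _.
  rewrite mulrCA ler_wpM2l ?exprn_ge0 // -!natrM ler_nat.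
  apply: leq_trans (card_isolated_le m_gt0 R_gt0 fE l g_deg f_dec) _.
  by rewrite leq_mul2r leq_mul2l card_small_subsets !orbT.
by rewrite -[leRHS]mulrA ler_wpM2l ?mulr_ge0 // sum_window_weights.
Qed.

End Combination.

(** * The circuit bound *)

Section CircuitBound.

Variables (K : realFieldType) (F : fieldType) (q p m R k lab s n a : nat) (x e : K).
Hypotheses (m_gt0 : (0 < m)%N) (R_gt0 : (0 < R)%N).
Hypotheses (a_gt0 : (0 < a)%N) (size_le : (q * p.+1 * p.+1 * lab.+1 <= a)%N).
Hypothesis len_le : ((k.+1 * (R * m).+1).*2.+1 <= n)%N.
Hypotheses (x_gt0 : 0 < x) (x_le1 : x <= 1) (e_ge0 : 0 <= e).

Local Notation phi := ((1 + x)^-1).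
Hypothesis phi_m : phi ^+ m = e ^+ 2.
Hypothesis p_small : p.+1%:R * phi ^+ m <= 1.
Hypothesis e_small : (1 + e) ^+ R <= 9 / 8.
Hypothesis q_small : (q * p.+1 ^ R.-1)%:R * (x * phi) ^+ (R * m) <= 4^-1.

Variable C : SPSP F #|imm_var a n|.
Hypotheses (C_homog : homogeneous_circuit C) (C_IMM : output C = IMM F n a_gt0).
Hypothesis mono_lt : (n_mono C < lab.+1 ^ s.+1)%N.

Lemma circuit_bound :
  (x ^+ s * ((q * p.+1 ^ R.-1)%:R * phi ^+ (R * m) / 2)) ^+ k.+1 <=
  (n_prod C)%:R * (n.+1 ^ k.+1)%:R * (k.+1 * s).+1%:R.
Proof.
pose r := blen m R; pose H := (k * r.+1 + r)%N.
have HE : H.+1 = (k.+1 * (R * m).+1)%N by rewrite mulSnr addnS.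
have sz : (#|{: state q p * 'I_lab.+1}| <= a)%N by rewrite !card_prod !card_ord.
have len : (H.+1.*2.+1 <= n)%N by rewrite HE.
have [rho good] := exists_good_labelling
  (fun g : 'I_(n_mono C) => mono_labels H sz g) mono_lt.
pose res := @restrict F _ _ _ _ n (@start q p) (@fin q p) (grel m R) rho sz a_gt0.
have resE A : res (IMM F n a_gt0) A = [exists c,
   valid_walk (@start q p) (@fin q p) (grel m R) c && (A == graph c)]%:R.
  exact: restrict_IMM.
have out_homog : output C \is n.-homog by rewrite C_IMM IMM_homog.
have [c [g [gP outE]]] := output_decomposition C_homog out_homog.
have g_deg i b A : res (g i b) A != 0 -> (#|A| <= s)%N.
  have [->|[j ->]] := gP i b; last exact: restrict_sum_deg.
  rewrite /res /restrict rmorph1 sqf1; case: (A =P set0) => [->|_]; last by rewrite eqxx.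
  by rewrite cards0.
have f_dec : res (IMM F n a_gt0) = \sum_i sqf_const _ (c i) * \prod_b res (g i b).
  rewrite -C_IMM outE /res /restrict rmorph_sum; apply: eq_bigr => i _.
  by rewrite rmorphM rmorph_prod /= mmapC.
have main := block_weight_exp_le m_gt0 R_gt0 x_gt0 x_le1 resE g_deg f_dec.
have low := block_weight_ge m_gt0 R_gt0 x_gt0 x_le1 e_ge0 phi_m p_small e_small q_small.
set N := #|{: zvar q p m R}| in main low.
have x1_gt0 : 0 < 1 + x by rewrite addr_gt0.
have xN_gt0 : 0 < (1 + x) ^+ (k.+1 * N) by rewrite exprn_gt0.
(* The total weight of all shift sets appears on both sides and cancels. *)
rewrite -(ler_pM2r xN_gt0); apply: le_trans main.
have -> : (1 + x) ^+ (k.+1 * N) = ((1 + x) ^+ N) ^+ k.+1 by rewrite mulnC exprM.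
have -> : x ^+ (k.+1 * s) = (x ^+ s) ^+ k.+1 by rewrite mulnC exprM.
have [x_ge0 phi_ge0] : 0 <= x /\ 0 <= phi by rewrite invr_ge0 !ltW.
have bw_ge0 : 0 <= block_weight q p m R x.
  by apply: sumr_ge0 => t _; rewrite exprn_ge0.
rewrite -!exprMn; apply: lerXn2r; rewrite ?nnegrE.
- by rewrite !mulr_ge0 ?exprn_ge0 ?invr_ge0 ?ler0n ?(ltW x1_gt0).
- by rewrite mulr_ge0 ?exprn_ge0.
rewrite -[leLHS]mulrA ler_wpM2l ?exprn_ge0 //; apply: le_trans low.
by rewrite [leLHS]mulrC !mulrA.
Qed.

End CircuitBound.

(** * Choice of parameters *)

Section ChoiceOfConstants.

Variables (K : realType) (nu : nat).
Hypothesis nu_big : expR 3000 <= nu%:R :> K.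

Let L : K := ln nu%:R.
(** Chosen so that [x ^+ nu] is the inverse square root of [nu]. *)
Let x : K := expR (- (L / (2 * nu%:R))).

Let nu_gt0 : 0 < nu%:R :> K. Proof. exact: lt_le_trans (expR_gt0 _) nu_big. Qed.
Let nuE : nu%:R = expR L :> K. Proof. by rewrite lnK // posrE. Qed.
Let L_ge : 3000 <= L. Proof. by rewrite -ler_expR -nuE. Qed.

Lemma ln_le_nat : 100 * L <= nu%:R.
Proof.
have := expR_ge1Dx (L / 2); rewrite nuE [in expR L](splitr L) expRD.
by have := L_ge; move: (expR (L / 2)) => E; nra.
Qed.

Let x_gt0 : 0 < x. Proof. exact: expR_gt0. Qed.

Lemma weight_le1 : x <= 1.
Proof.
rewrite -expR0 ler_expR oppr_le0 divr_ge0 //; last by rewrite mulr_ge0 // ltW.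
by have := L_ge; lra.
Qed.

Let x_ge : 1 / 2 <= x.
Proof.
apply: le_trans (expR_ge1Dx _).
have : L / (2 * nu%:R) <= 1 / 2.
  rewrite ler_pdivrMr ?mulr_gt0 //; have := ln_le_nat; have := L_ge; lra.
lra.
Qed.

Lemma weight_exp : x ^+ nu = expR (- (L / 2)).
Proof.
rewrite -expRM_natl; congr expR.
by have nz := lt0r_neq0 nu_gt0; field.
Qed.

(** With [1 + x] between [expR (1 / 3)] and [expR 1], the largest exponent is between about [2 * L]
    and [6 * L]. *)
Lemma exists_m : exists m, [/\ (1 + x) ^+ m <= nu%:R ^+ 2, nu%:R ^+ 2 < (1 + x) ^+ m.+1,
  (200 <= m)%N & (m <= nu)%N].
Proof.
have x_le1 := weight_le1; have nu_le m : (1 + x) ^+ m <= nu%:R ^+ 2 -> (m <= nu)%N.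
  move=> le; have third : expR (1 / 3) <= 1 + x.
    have := expR_ge1Dx (- (1 / 3) : K); rewrite expRN => h.
    have := expR_gt0 (1 / 3 : K) => E_gt0.
    have := ler_wpM2r (ltW E_gt0) h; rewrite mulVf ?gt_eqF //.
    by have := x_ge; lra.
  have : expR (m%:R * (1 / 3)) <= expR (2%:R * L).
    rewrite expRM_natl expRM_natl -nuE; apply: le_trans le.
    by apply: lerXn2r; rewrite ?nnegrE ?expR_ge0 // addr_ge0 // ltW.
  rewrite ler_expR => le2; rewrite -(ler_nat K).
  by have := ln_le_nat; have := L_ge; lra.
have ex : exists m, nu%:R ^+ 2 < (1 + x) ^+ m.
  by exists nu.+1; rewrite ltNge; apply/negP => /nu_le; rewrite ltnn.
case: (ex_minnP ex) => -[|m] gt min_m.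
  have : 1 <= nu%:R ^+ 2 :> K.
    by rewrite exprn_ege1 //; have := ln_le_nat; have := L_ge; lra.
  by rewrite leNgt gt.
have le : (1 + x) ^+ m <= nu%:R ^+ 2.
  by rewrite leNgt; apply/negP => /min_m; rewrite ltnn.
exists m; split => //; last exact: nu_le.
have : expR (2%:R * L) < expR (m.+1%:R * 1).
  rewrite expRM_natl expRM_natl -nuE; apply: lt_le_trans gt _.
  apply: lerXn2r; rewrite ?nnegrE ?expR_ge0 ?addr_ge0 //; first exact: ltW.
  apply: le_trans (expR_ge1Dx _); rewrite lerD2l //.
rewrite ltr_expR -(ler_nat K) -(natr1 m) => lt.
by have := L_ge; lra.
Qed.

Let bernoulli (a : K) (n : nat) : 0 <= a <= 1 -> 1 - n%:R * a <= (1 - a) ^+ n.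
Proof.
case/andP=> a0 a1; elim: n => [|n IH]; first by rewrite mul0r subr0.
have := ler_wpM2l (_ : 0 <= 1 - a) IH; rewrite -exprS subr_ge0 => /(_ a1).
apply: le_trans; rewrite -natr1; have := mulr_ge0 (mulr_ge0 (ler0n K n) a0) a0.
by move: (n%:R : K) => N; lra.
Qed.

(* m is maximal with (1 + x)^m <= nu^2, p.+1 is the integer part of (1 + x)^m, e^2 = (1 + x)^-m and R is least with
   R m > 7 nu. *)
Lemma parameters : exists m p R e, [/\ (0 < m)%N, (0 < R)%N, (p.+1 <= nu ^ 2)%N,
    (R * m <= 8 * nu)%N & 0 <= e] /\ [/\ (1 + x)^-1 ^+ m = e ^+ 2,
    p.+1%:R * (1 + x)^-1 ^+ m <= 1, (1 + e) ^+ R <= 9 / 8,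
    (nu ^ 5 * p.+1 ^ R.-1)%:R * (x * (1 + x)^-1) ^+ (R * m) <= 4^-1 &
    expR (- (L / 2)) * nu%:R ^+ 3 / 4 <=
      x ^+ nu * ((nu ^ 5 * p.+1 ^ R.-1)%:R * (1 + x)^-1 ^+ (R * m) / 2)].
Proof.
have x_le1 := weight_le1; have [m [tle tgt m_ge m_le]] := exists_m.
have m_gt0 : (0 < m)%N by apply: leq_trans m_ge.
set t := (1 + x) ^+ m in tle tgt; set n := nu%:R in tle tgt.
have n_ge : 3000 <= n by have := ln_le_nat; have := L_ge; rewrite /n; lra.
have x1_gt0 : 0 < 1 + x by rewrite addr_gt0.
have t_gt0 : 0 < t by apply: exprn_gt0.
(* Maximality of [m] and [1 + x <= 2] place [t] within a factor 2 of [n ^+ 2]; here [n] abbreviates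
   [nu]. *)
have t_big : n ^+ 2 < 2 * t.
  apply: lt_le_trans tgt _; rewrite exprS ler_wpM2r ?(ltW t_gt0) //.
  by have := weight_le1; lra.
set eta := (1 + x)^-1 ^+ m.
have etaE : eta * t = 1 by rewrite /eta /t exprVn mulVf // expf_neq0 // gt_eqF.
have eta_gt0 : 0 < eta by rewrite exprn_gt0 // invr_gt0.
have [P Ple Pgt] : exists2 P : nat, P%:R <= t & t < P.+1%:R.
  exists (Num.truncn t); first by rewrite truncn_le ltW.
  by rewrite truncnS_gt.
case: P Ple Pgt => [|p] Ple Pgt; first by move: Pgt t_big n_ge; nra.
pose e := Num.sqrt eta.
have e_ge0 : 0 <= e by apply: sqrtr_ge0.
have e2 : e ^+ 2 = eta by rewrite sqr_sqrtr // ltW.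
have en_le : e * n <= 3 / 2.
  have : e ^+ 2 * n ^+ 2 < 2.
    rewrite e2; have := ltr_pM2l eta_gt0 (n ^+ 2) (2 * t); rewrite t_big.
    by move=> lt; apply: lt_le_trans lt _; rewrite mulrCA etaE mulr1.
  have : 0 <= e * n by rewrite mulr_ge0 // ler0n.
  by rewrite -exprMn; move: (e * n) => a; nra.
pose R := ((7 * nu) %/ m).+1.
have Rm_ge : (7 * nu <= R * m)%N by rewrite ltnW // ltn_ceil.
have Rm_le : (R * m <= 8 * nu)%N.
  rewrite /R mulSn (_ : 8 * nu = nu + 7 * nu)%N; last by rewrite -mulSn.
  by rewrite leq_add // leq_trunc_div.
have eR_le : e * R%:R <= 1 / 10.
  have : R%:R * 200 <= 8 * n.
    rewrite /n -!natrM ler_nat; apply: leq_trans Rm_le.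
    by rewrite leq_mul2l m_ge orbT.
  by move: (R%:R : K) => r h; nra.
have Pe1 : p.+1%:R * eta <= 1 by rewrite -[leRHS]etaE mulrC ler_wpM2l // ltW.
have Pe2 : 1 - eta <= p.+1%:R * eta.
  have := ler_wpM2l (ltW eta_gt0) (ltW Pgt); rewrite etaE -natr1 mulrDr mulr1.
  by rewrite [eta * _]mulrC; lra.
have eta_small : eta <= 1 / 10.
  by rewrite -e2; have := n_ge; nra.
have Pe_pow1 : (p.+1%:R * eta) ^+ R.-1 <= 1.
  by rewrite exprn_ile1 // mulr_ge0 // ltW.
(* Rounding [t] down to [p.+1] loses a factor of at least [1 - eta] per vertex; by the Bernoulli
   inequality the total loss is at most one half. *)
have Pe_pow2 : 1 / 2 <= (p.+1%:R * eta) ^+ R.-1.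
  have h : 0 <= eta <= 1 by rewrite ltW //=; have := eta_small; lra.
  apply: le_trans (le_trans (bernoulli R.-1 h) (_ : _ <= _)); last first.
    by apply: lerXn2r => //; rewrite nnegrE ?mulr_ge0 ?(ltW eta_gt0) // subr_ge0; case/andP: h.
  have : R.-1%:R * eta <= 1 / 2; last by lra.
  apply: le_trans (_ : R%:R * eta <= _); first by rewrite ler_wpM2r ?ler_nat // ltW.
  by rewrite -e2 expr2 mulrCA; have := eR_le; nra.
(* Applied with [z = x] to the competitors and with [z = 1] to the walks. A single [eta] is left
   over, since [R] segments have only [R.-1] free vertices. *)
have Yfac (z : K) : (nu ^ 5 * p.+1 ^ R.-1)%:R * (z * (1 + x)^-1) ^+ (R * m) =
    n ^+ 5 * z ^+ (R * m) * eta * (p.+1%:R * eta) ^+ R.-1.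
  have -> : (z * (1 + x)^-1) ^+ (R * m) = z ^+ (R * m) * (eta * eta ^+ R.-1).
    by rewrite exprMn -exprS prednK // /eta -exprM [(m * R)%N]mulnC.
  rewrite natrM !natrX exprMn -/n.
  move: (z ^+ _) (eta ^+ _) (p.+1%:R ^+ _ : K) (n ^+ _) => a b c d; ring.
pose y : K := expR (- (L / 2)).
have y_gt0 : 0 < y by apply: expR_gt0.
have yn : y ^+ 2 * n = 1.
  by rewrite /n nuE -expRM_natl -expRD [_ + _](_ : _ = 0) ?expR0 //; lra.
have y_small : y <= 1 / 8.
  have : y * expR (L / 2) = 1 by rewrite -expRD addNr expR0.
  have := expR_ge1Dx (L / 2); have := L_ge; move: (expR _) => E; nra.
exists m, p, R, e; split; split => //.
- rewrite -(ler_nat K) natrX; exact: le_trans tle.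
- apply: le_trans (_ : expR (e * R%:R) <= _).
    rewrite expRM_natr; apply: lerXn2r; rewrite ?nnegrE ?expR_ge0 ?addr_ge0 //.
    exact: expR_ge1Dx.
  apply: le_trans (_ : expR (1 / 10) <= _); first by rewrite ler_expR.
  have := expR_ge1Dx (- (1 / 10) : K); have : expR (- (1 / 10)) * expR (1 / 10) = 1 :> K.
    by rewrite -expRD addNr expR0.
  have := expR_gt0 (1 / 10 : K); move: (expR (1 / 10)) (expR (- (1 / 10))) => E E'; nra.
- rewrite Yfac.
  have xR : x ^+ (R * m) <= y ^+ 7.
    by rewrite /y -weight_exp -exprM [(nu * 7)%N]mulnC ler_wiXn2l // ltW.
  apply: le_trans (_ : n ^+ 5 * y ^+ 7 * eta * 1 <= _).
    apply: ler_pM => //.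
    - apply: mulr_ge0 (ltW eta_gt0); apply: mulr_ge0; apply: exprn_ge0.
        exact: ler0n.
      exact: ltW.
    - by rewrite exprn_ge0 // mulr_ge0 ?ler0n // ltW.
    by rewrite ler_wpM2r ?(ltW eta_gt0) // ler_wpM2l // exprn_ge0 // ler0n.
  (* As [y ^+ 2 * n = 1], what remains is [y * (n ^+ 2 * eta)], at most [(1 / 8) * 2]. *)
  have -> : n ^+ 5 * y ^+ 7 * eta * 1 = (y ^+ 2 * n) ^+ 3 * y * (n ^+ 2 * eta) by ring.
  rewrite yn expr1n mul1r.
  have : n ^+ 2 * eta <= 2.
    have := ler_wpM2l (ltW eta_gt0) (ltW t_big).
    by rewrite [eta * (2 * t)]mulrCA etaE mulr1 mulrC.
  by move: (n ^+ 2 * eta) => a; nra.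
- rewrite weight_exp -/y -[(1 + x)^-1]mul1r Yfac expr1n mulr1.
  (* From [t <= n ^+ 2]: the [nu ^ 5] copies outweigh the leftover [eta]. *)
  have h1 : n ^+ 3 <= n ^+ 5 * eta.
    have : 1 <= n ^+ 2 * eta by rewrite -[leLHS]etaE mulrC ler_wpM2r // ltW.
    have n3 : 0 <= n ^+ 3 by rewrite exprn_ge0 // ler0n.
    by move/(ler_wpM2l n3); rewrite mulr1 mulrA -exprD.
  have h2 : n ^+ 3 / 2 <= n ^+ 5 * eta * (p.+1%:R * eta) ^+ R.-1.
    have := ler_pM (_ : 0 <= n ^+ 3) (_ : 0 <= 1 / 2 :> K) h1 Pe_pow2.
    rewrite mul1r; apply; rewrite ?exprn_ge0 ?ler0n //; lra.
  have := ler_wpM2l (ltW y_gt0) h2; move: (n ^+ 5 * _ * _) => A h; lra.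
Qed.

End ChoiceOfConstants.

(** * Asymptotic estimates and conclusion *)

Lemma nat_sqrt (n : nat) : exists nu, (nu ^ 2 <= n < nu.+1 ^ 2)%N.
Proof.
elim: n => [|n [nu /andP[le lt]]]; first by exists 0%N.
have [lt'|ge] := ltnP n.+1 (nu.+1 ^ 2); first by exists nu; rewrite leqW.
exists nu.+1; rewrite ge /=; apply: leq_trans (_ : (nu.+1 ^ 2).+1 <= _)%N => //.
by rewrite ltn_exp2r.
Qed.

Lemma n_mono_le_size (F : fieldType) (N : nat) (C : SPSP F N) :
  (n_mono C <= circuit_size C)%N.
Proof. by rewrite /circuit_size; lia. Qed.

Lemma n_prod_le_size (F : fieldType) (N : nat) (C : SPSP F N) :
  (n_prod C <= circuit_size C)%N.
Proof. by rewrite /circuit_size; lia. Qed.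

(** Each position takes two layers, so [kap] blocks need about [16 * kap * nu] layers; the divisor
    18 leaves room for the lower-order terms. *)
Lemma layers_le (nu kap r : nat) : (100 <= nu)%N -> (kap * 18 <= nu)%N -> (r <= 8 * nu)%N ->
  ((kap * r.+1).*2.+1 <= nu ^ 2)%N.
Proof.
move=> nu_ge kap_le r_le.
have h : (kap * 18 * r.+1 <= nu * (8 * nu).+1)%N by apply: leq_mul.
have h2 : (100 * nu <= nu * nu)%N by apply: leq_mul.
rewrite mulnAC (mulnS nu) (mulnCA nu 8 nu) in h.
by rewrite -[(nu ^ 2)%N]mulnn; move: h h2 nu_ge; clear; lia.
Qed.

Lemma sqrt_succ_le (nu n : nat) : (100 <= nu)%N -> (n < nu.+1 ^ 2)%N ->
  (n.+1 <= 4 * nu ^ 2)%N /\ (n <= nu ^ 3)%N.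
Proof.
move=> nu_ge n_lt; have h : (100 * nu <= nu * nu)%N by apply: leq_mul.
have h3 : (100 * (nu * nu) <= nu * (nu * nu))%N by apply: leq_mul.
have e : (nu.+1 ^ 2 = nu * nu + 2 * nu + 1)%N by rewrite -mulnn mulSn mulnS; lia.
rewrite e in n_lt; rewrite (expnS nu 2) -mulnn; split; lia.
Qed.

Section Asymptotics.

Variables (K : realType) (nu : nat).
Hypothesis nu_big : expR 3000 <= nu%:R :> K.

Local Notation L := (ln nu%:R : K).

Lemma nu_pos : 0 < nu%:R :> K.
Proof. exact: lt_le_trans (expR_gt0 _) nu_big. Qed.

Lemma natr_expR_ln : nu%:R = expR L.
Proof. by rewrite lnK // posrE nu_pos. Qed.

Lemma ln_nu_ge : 3000 <= L.
Proof. by rewrite -ler_expR -natr_expR_ln. Qed.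

Lemma nu_ge : (100 <= nu)%N.
Proof. by rewrite -(ler_nat K); have := ln_le_nat nu_big; have := ln_nu_ge; lra. Qed.

Lemma ln_scaled_le : L * nu%:R / 300 <= nu.+1%:R * L.
Proof.
have h : 0 <= L * nu%:R by rewrite mulr_ge0 ?ler0n //; have := ln_nu_ge; lra.
by rewrite -(natr1 nu) mulrDl mul1r [_ * L]mulrC; have := ln_nu_ge; lra.
Qed.

(** Each block gains [nu^(5/2) / 4] against a loss of [n.+1 <= 4 nu^2], a net factor of at least
    [nu^(1/4)]. The remaining factor is at most [nu^2] in total, and [kap] is about [nu / 18]. *)
Lemma lower_bound_of_product (n kap : nat) (T : K) :
    (n < nu.+1 ^ 2)%N -> (kap * 18 <= nu)%N -> (nu < kap.+1 * 18)%N -> 0 <= T ->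
    (expR (- (L / 2)) * nu%:R ^+ 3 / 4) ^+ kap <=
      T * (n.+1 ^ kap)%:R * (kap * nu).+1%:R ->
  expR (L * nu%:R / 300) <= T.
Proof.
move=> n_lt kap18 kap_lt T_ge0 lower.
have L_ge := ln_nu_ge; have nuE := natr_expR_ln; have nu_ge := nu_ge.
set A := expR (2%:R * L); have A_gt0 : 0 < A by apply: expR_gt0.
have AE : A = (nu ^ 2)%:R by rewrite /A expRM_natl -nuE natrX.
have n1_le : n.+1%:R <= 4 * A.
  by rewrite AE -natrM ler_nat; have [] := sqrt_succ_le nu_ge n_lt.
have kn_le : (kap * nu).+1%:R <= A.
  rewrite AE ler_nat -mulnn; have : (kap * 18 * nu <= nu * nu)%N by apply: leq_mul.
  have : (100 * nu <= nu * nu)%N by apply: leq_mul.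
  by rewrite mulnAC; move: (kap * nu)%N (nu * nu)%N nu_ge => a b; clear; lia.
set E := expR (L / 4).
have E16 : 16 <= E by apply: le_trans (expR_ge1Dx _); lra.
have base_ge : E * (4 * A) <= expR (- (L / 2)) * nu%:R ^+ 3 / 4.
  have -> : nu%:R ^+ 3 = expR (3%:R * L) by rewrite expRM_natl -nuE.
  rewrite -expRD.
  rewrite [X in expR X / 4](_ : _ = 2%:R * L + (L / 4 + L / 4)); last by field.
  rewrite !expRD -/A -/E; have : 0 <= A * E * (E - 16).
    by rewrite mulr_ge0 ?subr_ge0 // mulr_ge0 ?expR_ge0 // ltW.
  by clear; move: A E => a b; lra.
have A4_ge0 : 0 <= 4 * A by rewrite mulr_ge0 ?ler0n // ltW.
have T_ge : expR (L / 4 * kap%:R) <= T * A.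
  have B_gt0 : 0 < (4 * A) ^+ kap by rewrite exprn_gt0 // mulr_gt0 // ltr0n.
  rewrite -(ler_pM2r B_gt0) expRM_natr -/E -exprMn.
  apply: le_trans (_ : (expR (- (L / 2)) * nu%:R ^+ 3 / 4) ^+ kap <= _).
    have E_ge0 : 0 <= E * (4 * A) by rewrite mulr_ge0 // expR_ge0.
    by apply: lerXn2r; rewrite ?nnegrE // (le_trans E_ge0).
  apply: le_trans lower _; rewrite [leRHS]mulrAC.
  apply: ler_pM; rewrite ?mulr_ge0 ?ler0n //.
  rewrite ler_wpM2l // natrX; apply: lerXn2r; rewrite ?nnegrE ?ler0n //.
rewrite -(ler_pM2r A_gt0); apply: le_trans T_ge; rewrite -expRD ler_expR.
have h : nu%:R <= (kap%:R + 1) * 18 :> K by rewrite natr1 -natrM ler_nat ltnW.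
have h2 := ln_le_nat nu_big.
move: L_ge h h2; clear; move: L (nu%:R : K) (kap%:R : K) => l v k; nra.
Qed.

End Asymptotics.

(** Either there are at least [nu ^ nu.+1] monomial gates, which suffices, or a labelling with [nu]
    labels bounds the degrees by [nu] and the product gates are counted. *)
Lemma circuit_size_ge (K : realType) (F : fieldType) (nu n : nat) (a_gt0 : (0 < n ^ 5)%N)
    (C : SPSP F #|imm_var (n ^ 5) n|) :
    expR 3000 <= nu%:R :> K -> (nu ^ 2 <= n < nu.+1 ^ 2)%N ->
    homogeneous_circuit C -> output C = IMM F n a_gt0 ->
  expR (ln nu%:R * nu%:R / 300) <= (circuit_size C)%:R :> K.
Proof.
move=> nu_big /andP[n_ge n_lt] C_homog C_IMM.
have nu_ge100 := nu_ge nu_big; have nu_gt0 : (0 < nu)%N by apply: leq_trans nu_ge100.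
have [mono_lt|mono_ge] := ltnP (n_mono C) (nu ^ nu.+1); last first.
  apply: (@le_trans _ _ (nu ^ nu.+1)%:R).
    by rewrite natrX [in X in _ <= X](natr_expR_ln nu_big) -expRM_natl ler_expR ln_scaled_le.
  by rewrite ler_nat (leq_trans mono_ge) // n_mono_le_size.
have [m [p [R [e [[m_gt0 R_gt0 p_le Rm_le e_ge0] [phi_m p_small e_small q_small low]]]]]] :=
  parameters nu_big.
have x_gt0 : 0 < expR (- (ln nu%:R / (2 * nu%:R))) :> K by apply: expR_gt0.
have x_le1 : expR (- (ln nu%:R / (2 * nu%:R))) <= 1 :> K by apply: weight_le1.
pose kap := (nu %/ 18)%N.
have kap_gt0 : (0 < kap)%N by rewrite divn_gt0 //; apply: leq_trans nu_ge100.
have kap18 : (kap * 18 <= nu)%N by apply: leq_trunc_div.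
have kap_lt : (nu < kap.+1 * 18)%N by apply: ltn_ceil.
(* Copies, pairs of vertices and labels together number at most [nu ^ (5 + 2 + 2 + 1)], which is
   [(nu ^ 2) ^ 5]. *)
have size_le : (nu ^ 5 * p.+1 * p.+1 * nu.-1.+1 <= n ^ 5)%N.
  rewrite prednK //; apply: (@leq_trans ((nu ^ 2) ^ 5)); last by rewrite leq_exp2r.
  rewrite (_ : (nu ^ 2) ^ 5 = nu ^ 5 * nu ^ 2 * nu ^ 2 * nu)%N; last first.
    by rewrite -!expnD -expnSr -expnM.
  by rewrite !leq_mul.
have len_le : ((kap.-1.+1 * (R * m).+1).*2.+1 <= n)%N.
  by rewrite prednK //; apply: leq_trans n_ge; apply: layers_le.
have := circuit_bound m_gt0 R_gt0 size_le len_le x_gt0 x_le1 e_ge0 phi_m p_small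
   e_small q_small C_homog C_IMM (s := nu).
rewrite !prednK // => /(_ mono_lt) bound.
apply: (@le_trans _ _ (n_prod C)%:R); last by rewrite ler_nat n_prod_le_size.
apply: (lower_bound_of_product nu_big n_lt kap18 kap_lt) => //.
apply: le_trans bound; apply: lerXn2r; rewrite ?nnegrE //.
  by rewrite !mulr_ge0 ?expR_ge0 ?exprn_ge0 ?invr_ge0 ?ler0n.
apply: le_trans low.
by rewrite !mulr_ge0 ?expR_ge0 ?exprn_ge0 ?invr_ge0 ?ler0n.
Qed.

Theorem theorem8p1 (R : realType) :
  exists c : R, 0 < c /\
  exists n0 : nat,
  forall (F : fieldType) (n : nat), (n0 <= n)%N ->
  let tn := (n ^ 5)%N in
  forall tn_gt0 : (0 < tn)%N,
  forall C : SPSP F #|imm_var tn n|,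
    homogeneous_circuit C ->
    output C = IMM F n tn_gt0 ->
    2 `^ (c * Num.sqrt n%:R * ln n%:R) <= (circuit_size C)%:R.
Proof.
(* The product [300 * 2 * 3] comes from the exponent [ln nu * nu / 300], [sqrt n <= 2 nu] and
   [ln n <= 3 ln nu]. *)
exists (1 / 1800); split; first by lra.
pose N := (Num.truncn (expR 3000 : R)).+1.
exists (N ^ 2)%N => F n n_big tn tn_gt0 C C_homog C_IMM.
have [nu nu_n] := nat_sqrt n; have /andP[n_ge n_lt] := nu_n.
have nu_big : expR 3000 <= nu%:R :> R.
  apply: le_trans (ltW (truncnS_gt _)) _; rewrite ler_nat -/N.
  by rewrite -ltnS -(ltn_exp2r _ _ (isT : 0 < 2)%N); apply: leq_ltn_trans n_big _.
apply: le_trans (circuit_size_ge nu_big nu_n C_homog C_IMM).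
have nu_gt0 : 0 < nu%:R :> R by apply: lt_le_trans (expR_gt0 _) nu_big.
have nu_ge100 := nu_ge nu_big.
have n_gt0 : 0 < n%:R :> R.
  by rewrite ltr0n; apply: leq_trans n_ge; rewrite expn_gt0 (leq_trans _ nu_ge100).
have [n_le4 n_le3] := sqrt_succ_le nu_ge100 n_lt.
have lnn : 0 <= ln n%:R :> R by rewrite ln_ge0 // ler1n -(ltr0n R).
have ln_le : ln n%:R <= 3 * ln nu%:R :> R.
  have -> : 3 * ln nu%:R = ln (nu%:R ^+ 3) :> R by rewrite lnXn // mulr_natl.
  by rewrite ler_ln ?posrE ?exprn_gt0 // -natrX ler_nat.
have sqrt_le : Num.sqrt n%:R <= 2 * nu%:R :> R.
  have -> : 2 * nu%:R = Num.sqrt ((2 * nu%:R) ^+ 2) :> R.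
    by rewrite sqrtr_sqr ger0_norm // mulr_ge0.
  by apply: ler_wsqrtr; rewrite -natrM -natrX ler_nat expnMn ltnW.
have z_ge0 : 0 <= 1 / 1800 * Num.sqrt n%:R * ln n%:R :> R.
  by rewrite !mulr_ge0 ?sqrtr_ge0 ?invr_ge0 ?ler01 ?ler0n.
(* Base 2 may be raised to base [expR 1], since the exponent is nonnegative. *)
apply: le_trans (_ : (expR 1) `^ (1 / 1800 * Num.sqrt n%:R * ln n%:R) <= _).
  by apply: ge0_ler_powR; rewrite ?nnegrE ?expR_ge0 //; exact: expR_ge1Dx.
rewrite -expRM mul1r ler_expR.
have := ler_pM (sqrtr_ge0 _) lnn sqrt_le ln_le; clear.
by move: (nu%:R : R) (ln nu%:R : R) (ln n%:R : R) (Num.sqrt _) => a b c d; lra.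
Qed.
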